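(* Let $p \in \mathbb{N}_{>0}\cup \{\infty\}$. The theory $T_{e,p}$ is complete.
   Context: Let $T$ be a complete o-minimal theory in a language $\mathcal{L}$ extending the theory of densely ordered groups with a distinguished positive element; $\operatorname{dcl}_T$ is definable closure in $T$. A set $S$ is $\operatorname{dcl}_T$-independent if no $s\in S$ lies in $\operatorname{dcl}_T(S\setminus\{s\})$; dense means meeting every nonempty open interval. Let $\mathcal{L}_e=\mathcal{L}\cup\{P,E\}$ with $P$ a unary and $E$ a binary predicate. $T_e$ is $T$ together with axiom schemata: (T1) $P$ is dense and $\operatorname{dcl}_T$-independent; (T2) $E\subseteq P^2$ is an equivalence relation on $P$; (T3) each equivalence class of $E$ is dense in $P$. $T_{e,\infty}$ is $T_e$ together with an axiom schema stating that $E$ has infinitely many equivalence classes; for $n\in\mathbb{N}_{>0}$, $T_{e,n}$ is $T_e$ together with a sentence stating that $E$ has exactly $n$ equivalence classes. *)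

(* Defs.v *)
From mathcomp Require Import all_boot.
From mathcomp Require Import boolp classical_sets.

Set Implicit Arguments.
Unset Strict Implicit.
Unset Printing Implicit Defensive.

Local Open Scope classical_set_scope.

(** * First-order logic *)

(* [func_sym L k] and [rel_sym L k] are the symbols of arity [k]; constants
   are the function symbols of arity 0. *)
Record language := Language { func_sym : nat -> Type; rel_sym : nat -> Type }.

Inductive term (L : language) (n : nat) : Type :=
| Var of 'I_n
| App k of func_sym L k & ('I_k -> term L n).
Arguments Var {L n} & _.
Arguments App {L n k}.

(* [form L n]: the formulas whose free variables are among v_0, ..., v_(n-1).
   A quantifier over [form L n.+1] binds the last variable v_n, so variables
   keep their number under binders. *)
Inductive form (L : language) : nat -> Type :=
| Bot n : form L n
| Eq n of term L n & term L n : form L n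
| Rel n k of rel_sym L k & ('I_k -> term L n) : form L n
| Imp n of form L n & form L n : form L n
| All n of form L n.+1 : form L n.
Arguments Bot {L n}.
Arguments Eq {L n} & _ _.
Arguments Rel {L n k} & _ _.
Arguments Imp {L n} & _ _.
Arguments All {L n} & _.

Notation sentence L := (form L 0).
Notation theory L := (set (sentence L)).

#[local] Arguments Ordinal {n} & {m} _.
Notation "''v_' i" := (Var (Ordinal (m := i) isT)) (at level 8, i at level 2).

Section Connectives.
Variable L : language.

Definition Not n (f : form L n) := Imp f Bot.
Definition Top n : form L n := Not Bot.
Definition Or n (f g : form L n) := Imp (Not f) g.
Definition And n (f g : form L n) := Not (Imp f (Not g)).
Definition Ex n (f : form L n.+1) : form L n := Not (All (Not f)).

End Connectives.
Arguments Top {L n}.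
Arguments Not {L n} & _.
Arguments Or {L n} & _ _.
Arguments And {L n} & _ _.
Arguments Ex {L n} & _.

Fixpoint close L n : form L n -> sentence L :=
  if n is m.+1 then fun f => close (All f) else id.

Arguments close {L n} & _.

Fixpoint close_ex L n : form L n -> sentence L :=
  if n is m.+1 then fun f => close_ex (Ex f) else id.

(* Renaming of variables. [lift ord_max : 'I_n -> 'I_n.+1] preserves values. *)
Definition rename_up m n (s : 'I_m -> 'I_n) (i : 'I_m.+1) : 'I_n.+1 :=
  if unlift ord_max i is Some j then lift ord_max (s j) else ord_max.

Fixpoint rename_term L m n (s : 'I_m -> 'I_n) (t : term L m) : term L n :=
  match t with
  | Var i => Var (s i)
  | App _ c ts => App c (fun i => rename_term s (ts i))
  end.

Fixpoint rename L m (f : form L m) : forall n, ('I_m -> 'I_n) -> form L n :=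
  match f with
  | Bot _ => fun n s => Bot
  | Eq _ t u => fun n s => Eq (rename_term s t) (rename_term s u)
  | Rel _ _ r ts => fun n s => Rel r (fun i => rename_term s (ts i))
  | Imp _ f1 f2 => fun n s => Imp (rename f1 s) (rename f2 s)
  | All _ f1 => fun n s => All (rename f1 (rename_up s))
  end.

(* Carriers are not required to be nonempty: the languages below have
   constants, which forces it. *)
Record structure (L : language) := Structure {
  carrier :> Type;
  fun_of : forall k, func_sym L k -> ('I_k -> carrier) -> carrier;
  rel_of : forall k, rel_sym L k -> ('I_k -> carrier) -> Prop }.
Arguments fun_of {L} s {k}.
Arguments rel_of {L} s {k}.

Definition snoc (A : Type) n (e : 'I_n -> A) (x : A) (i : 'I_n.+1) : A :=
  if unlift ord_max i is Some j then e j else x.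

Definition env0 (A : Type) (i : 'I_0) : A := False_rect A (notF (ltn_ord i)).

Section Semantics.
Variables (L : language).

Fixpoint eval (M : structure L) n (e : 'I_n -> M) (t : term L n) : M :=
  match t with
  | Var i => e i
  | App _ c ts => fun_of M c (fun i => eval e (ts i))
  end.

Fixpoint sat (M : structure L) n (f : form L n) : ('I_n -> M) -> Prop :=
  match f with
  | Bot _ => fun e => False
  | Eq _ t u => fun e => eval e t = eval e u
  | Rel _ _ r ts => fun e => rel_of M r (fun i => eval e (ts i))
  | Imp _ f1 f2 => fun e => sat f1 e -> sat f2 e
  | All _ f1 => fun e => forall x : M, sat f1 (snoc e x)
  end.

Definition holds (M : structure L) (f : sentence L) : Prop := sat f (@env0 M).

Definition models (M : structure L) (T : theory L) : Prop :=
  forall f, T f -> holds M f.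

Definition entails (T : theory L) (f : sentence L) : Prop :=
  forall M : structure L, models M T -> holds M f.

Definition satisfiable (T : theory L) : Prop :=
  exists M : structure L, models M T.

Definition complete (T : theory L) : Prop :=
  satisfiable T /\ forall f, entails T f \/ entails T (Not f).

(* Definability with parameters from [A]; the tested element is the value of
   the last variable. *)
Definition definable (M : structure L) (A X : set M) : Prop :=
  exists (n : nat) (f : form L n.+1) (a : 'I_n -> M),
    (forall i, A (a i)) /\ X = [set x | sat f (snoc a x)].

Definition dcl (M : structure L) (A : set M) : set M :=
  [set x | definable A [set x]].

Definition dcl_independent (M : structure L) (S : set M) : Prop :=
  forall s, S s -> ~ dcl (S `\ s) s.

End Semantics.

(** * Languages extending that of ordered groups with a distinguished element *)

Record og_language := OgLanguage {
  og_lang :> language;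
  zero_sym : func_sym og_lang 0;
  one_sym : func_sym og_lang 0;
  add_sym : func_sym og_lang 2;
  opp_sym : func_sym og_lang 1;
  lt_sym : rel_sym og_lang 2 }.

Section OrderedGroups.
Variable L : og_language.

Definition tzero n : term L n := App (zero_sym L) (@env0 _).
Definition tone n : term L n := App (one_sym L) (@env0 _).
Definition tadd n (t u : term L n) := App (add_sym L) (tnth [tuple t; u]).
Definition topp n (t : term L n) := App (opp_sym L) (tnth [tuple t]).
Definition flt n (t u : term L n) := Rel (lt_sym L) (tnth [tuple t; u]).
Arguments tadd {n} & _ _.
Arguments topp {n} & _.
Arguments flt {n} & _ _.

(* Commutativity of the group is not part of the theory. *)
Inductive dense_og_axiom : theory L :=
| og_addA : dense_og_axiom (close (n := 3)
    (Eq (tadd 'v_0 (tadd 'v_1 'v_2)) (tadd (tadd 'v_0 'v_1) 'v_2)))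
| og_add0l : dense_og_axiom (close (n := 1) (Eq (tadd (tzero _) 'v_0) 'v_0))
| og_add0r : dense_og_axiom (close (n := 1) (Eq (tadd 'v_0 (tzero _)) 'v_0))
| og_addNl : dense_og_axiom
    (close (n := 1) (Eq (tadd (topp 'v_0) 'v_0) (tzero _)))
| og_addNr : dense_og_axiom
    (close (n := 1) (Eq (tadd 'v_0 (topp 'v_0)) (tzero _)))
| og_lt_irr : dense_og_axiom (close (n := 1) (Not (flt 'v_0 'v_0)))
| og_lt_trans : dense_og_axiom (close (n := 3)
    (Imp (flt 'v_0 'v_1) (Imp (flt 'v_1 'v_2) (flt 'v_0 'v_2))))
| og_lt_total : dense_og_axiom (close (n := 2)
    (Or (flt 'v_0 'v_1) (Or (Eq 'v_0 'v_1) (flt 'v_1 'v_0))))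
| og_lt_add2l : dense_og_axiom (close (n := 3)
    (Imp (flt 'v_0 'v_1) (flt (tadd 'v_2 'v_0) (tadd 'v_2 'v_1))))
| og_lt_add2r : dense_og_axiom (close (n := 3)
    (Imp (flt 'v_0 'v_1) (flt (tadd 'v_0 'v_2) (tadd 'v_1 'v_2))))
| og_lt_dense : dense_og_axiom (close (n := 2)
    (Imp (flt 'v_0 'v_1) (Ex (And (flt 'v_0 'v_2) (flt 'v_2 'v_1)))))
| og_lt01 : dense_og_axiom (flt (tzero _) (tone _)).

Definition lt_of (M : structure L) (x y : M) : Prop :=
  rel_of M (lt_sym L) (tnth [tuple x; y]).

(* Open intervals; [None] stands for -oo on the left and +oo on the right. *)
Definition open_interval (M : structure L) (a b : option M) : set M :=
  [set x | (if a is Some c then lt_of c x else True) /\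
           (if b is Some d then lt_of x d else True)].

Definition point_or_interval (M : structure L) (B : set M) : Prop :=
  (exists a, B = [set a]) \/ (exists a b, B = open_interval a b).

Definition ominimal (M : structure L) : Prop :=
  forall X : set M, definable setT X ->
    exists (k : nat) (B : 'I_k -> set M),
      (forall i, point_or_interval (B i)) /\ X = \bigcup_i B i.

Definition ominimal_theory (T : theory L) : Prop :=
  forall M : structure L, models M T -> ominimal M.

End OrderedGroups.
Arguments tadd {L n} & _ _.
Arguments topp {L n} & _.
Arguments flt {L n} & _ _.

(** * The language L_e and the theories T_e, T_(e,n), T_(e,oo) *)

Inductive rel_sym_e (L : language) : nat -> Type :=
| old_rsym k of rel_sym L k : rel_sym_e L k
| P_sym : rel_sym_e L 1
| E_sym : rel_sym_e L 2.
Arguments old_rsym {L k}.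
Arguments P_sym {L}.
Arguments E_sym {L}.

Definition lang_e (L : og_language) : og_language :=
  @OgLanguage (Language (func_sym L) (rel_sym_e L))
    (zero_sym L) (one_sym L) (add_sym L) (opp_sym L) (old_rsym (lt_sym L)).

Section LanguageE.
Variable L : og_language.

Fixpoint embed_term n (t : term L n) : term (lang_e L) n :=
  match t with
  | Var i => Var i
  | App _ c ts => App (c : func_sym (lang_e L) _) (fun i => embed_term (ts i))
  end.

Fixpoint embed n (f : form L n) : form (lang_e L) n :=
  match f with
  | Bot _ => Bot
  | Eq _ t u => Eq (embed_term t) (embed_term u)
  | Rel _ _ r ts => Rel (old_rsym r : rel_sym (lang_e L) _)
                        (fun i => embed_term (ts i))
  | Imp _ f1 f2 => Imp (embed f1) (embed f2)
  | All _ f1 => All (embed f1)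
  end.

Definition fP n (t : term (lang_e L) n) : form (lang_e L) n :=
  Rel (P_sym : rel_sym (lang_e L) 1) (tnth [tuple t]).
Definition fE n (t u : term (lang_e L) n) : form (lang_e L) n :=
  Rel (E_sym : rel_sym (lang_e L) 2) (tnth [tuple t; u]).
Definition fbetween n (t u w : term (lang_e L) n) : form (lang_e L) n :=
  And (flt t u) (flt u w).
Arguments fP {n} & _.
Arguments fE {n} & _ _.
Arguments fbetween {n} & _ _ _.

Definition P_dense : sentence (lang_e L) := close (n := 2)
  (Imp (Ex (fbetween 'v_0 'v_2 'v_1))
       (Ex (And (fP 'v_2) (fbetween 'v_0 'v_2 'v_1)))).

(* No v_n in P is the unique solution of f(v_0, ..., v_(n-1), -), where
   v_0, ..., v_(n-1) are in P and different from v_n. *)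
Definition P_indep n (f : form L n.+1) : sentence (lang_e L) :=
  close (n := n.+1)
   (Imp (\big[@And _ _/Top]_(i < n.+1) fP (Var i))
   (Imp (\big[@And _ _/Top]_(i < n) Not (Eq (Var (lift ord_max i)) (Var ord_max)))
   (Imp (embed f)
        (Ex (And (embed (rename f (rename_up (lift ord_max))))
                 (Not (Eq (Var ord_max) (Var (lift ord_max ord_max))))))))).

Inductive T1_axiom : theory (lang_e L) :=
| T1_dense : T1_axiom P_dense
| T1_indep n (f : form L n.+1) : T1_axiom (P_indep f).

Inductive T2_axiom : theory (lang_e L) :=
| T2_sub : T2_axiom (close (n := 2)
    (Imp (fE 'v_0 'v_1) (And (fP 'v_0) (fP 'v_1))))
| T2_refl : T2_axiom (close (n := 1) (Imp (fP 'v_0) (fE 'v_0 'v_0)))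
| T2_sym : T2_axiom (close (n := 2) (Imp (fE 'v_0 'v_1) (fE 'v_1 'v_0)))
| T2_trans : T2_axiom (close (n := 3)
    (Imp (fE 'v_0 'v_1) (Imp (fE 'v_1 'v_2) (fE 'v_0 'v_2)))).

(* The class of v_0 meets every open interval ]v_1, v_2[ that meets P. *)
Definition class_dense : sentence (lang_e L) := close (n := 3)
  (Imp (fP 'v_0)
  (Imp (Ex (And (fP 'v_3) (fbetween 'v_1 'v_3 'v_2)))
       (Ex (And (fE 'v_0 'v_3) (fbetween 'v_1 'v_3 'v_2))))).

Definition inequivalent n : form (lang_e L) n :=
  And (\big[@And _ _/Top]_(i < n) fP (Var i))
      (\big[@And _ _/Top]_(i < n) \big[@And _ _/Top]_(j < n | i != j)
         Not (fE (Var i) (Var j))).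

Definition at_least_classes n : sentence (lang_e L) :=
  close_ex (inequivalent n).

Definition exactly_classes n : sentence (lang_e L) :=
  close_ex (And (inequivalent n)
    (All (Imp (fP (Var ord_max))
              (\big[@Or _ _/Bot]_(i < n)
                 fE (Var (lift ord_max i)) (Var ord_max))))).

Variable T : theory L.

Definition Te : theory (lang_e L) :=
  (@embed 0 @` T) `|` T1_axiom `|` T2_axiom `|` [set class_dense].

Definition Te_infty : theory (lang_e L) :=
  Te `|` [set at_least_classes n | n in [set: nat]].

Definition Te_fin (n : nat) : theory (lang_e L) :=
  Te `|` [set exactly_classes n].

(* [Some n] stands for the natural number n, [None] for infinity. *)
Definition Te_p (p : option nat) : theory (lang_e L) :=
  if p is Some n then Te_fin n else Te_infty.

End LanguageE.
Arguments fP {L n} & _.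
Arguments fE {L n} & _ _.
Arguments fbetween {L n} & _ _ _.

(** * What the axioms of the theories T_(e,p) mean in a structure *)

Definition reduct (L : og_language) (M : structure (lang_e L)) : structure L :=
  Structure (fun k (c : func_sym L k) => fun_of M (c : func_sym (lang_e L) k))
            (fun k (r : rel_sym L k) =>
               rel_of M (old_rsym r : rel_sym (lang_e L) k)).

Definition P_of (L : og_language) (M : structure (lang_e L)) : set (reduct M) :=
  [set x | rel_of M (P_sym : rel_sym (lang_e L) 1) (tnth [tuple (x : M)])].

Definition E_of (L : og_language) (M : structure (lang_e L)) (x y : reduct M) :=
  rel_of M (E_sym : rel_sym (lang_e L) 2) (tnth [tuple (x : M); (y : M)]).

Definition dense_in (L : og_language) (M : structure L) (X D : set M) : Prop :=
  forall a b, X `&` open_interval (Some a) (Some b) !=set0 ->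
              D `&` open_interval (Some a) (Some b) !=set0.

Section Meaning.

Lemma unlift_max n (i : 'I_n) : unlift ord_max (lift ord_max i) = Some i.
Proof. exact: liftK. Qed.

Lemma snoc_lift (A : Type) n (e : 'I_n -> A) x i :
  snoc e x (lift ord_max i) = e i.
Proof. by rewrite /snoc liftK. Qed.

Lemma snoc_max (A : Type) n (e : 'I_n -> A) x : snoc e x ord_max = x.
Proof. by rewrite /snoc unlift_none. Qed.

Lemma env0E (A : Type) (e : 'I_0 -> A) : e = @env0 A.
Proof. by apply: funext; case. Qed.

Lemma snocE (A : Type) n (e : 'I_n.+1 -> A) :
  snoc (fun i => e (lift ord_max i)) (e ord_max) = e.
Proof.
apply: funext => i; case: (unliftP ord_max i) => [j|] ->.
  by rewrite snoc_lift.
by rewrite snoc_max.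
Qed.

Lemma eval_rename (L : language) (M : structure L) m n (s : 'I_m -> 'I_n)
    (t : term L m) (e : 'I_n -> M) :
  eval e (rename_term s t) = eval (e \o s) t.
Proof.
elim: t => //= k c ts IH; congr fun_of; exact/funext.
Qed.

Lemma snoc_rename_up (A : Type) m n (s : 'I_m -> 'I_n) (e : 'I_n -> A) x :
  snoc e x \o rename_up s = snoc (e \o s) x.
Proof.
apply: funext => i; rewrite /= /rename_up.
case: (unliftP ord_max i) => [j|] ->; first by rewrite !snoc_lift.
by rewrite !snoc_max.
Qed.

Lemma sat_rename (L : language) (M : structure L) m (f : form L m) n
    (s : 'I_m -> 'I_n) (e : 'I_n -> M) :
  sat (rename f s) e <-> sat f (e \o s).
Proof.
elim: f n s e => [{}m|{}m t u|{}m k r ts|{}m f IHf g IHg|{}m f IHf] n s e //=.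
- by rewrite !eval_rename.
- suff -> : (fun i => eval e (rename_term s (ts i)))
     = (fun i => eval (e \o s) (ts i)) by [].
  by apply: funext => i; rewrite eval_rename.
- by rewrite IHf IHg.
- by split=> H x; have := H x; rewrite IHf snoc_rename_up.
Qed.

Lemma sat_embed (L : og_language) (M : structure (lang_e L)) n (f : form L n)
    (e : 'I_n -> M) :
  sat (embed f) e <-> @sat L (reduct M) n f e.
Proof.
have evalE m (t : term L m) (d : 'I_m -> M) :
    eval d (embed_term t) = @eval L (reduct M) m d t.
  by elim: t => //= k c ts IH; congr (fun_of M); apply: funext.
elim: f e => [{}n|{}n t u|{}n k r ts|{}n f IHf g IHg|{}n f IHf] e //=.
- by rewrite !evalE.
- suff -> : (fun i => eval e (embed_term (ts i)))
     = (fun i => @eval L (reduct M) n e (ts i)) by [].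
  by apply: funext => i; rewrite evalE.
- by rewrite IHf IHg.
- by split=> H x; have := H x; rewrite IHf.
Qed.

Section Sat.
Variables (L : language) (M : structure L) (n : nat) (e : 'I_n -> M).

Lemma sat_Not (f : form L n) : sat (Not f) e <-> ~ sat f e. Proof. by []. Qed.

Lemma sat_Imp (f g : form L n) : sat (Imp f g) e <-> (sat f e -> sat g e).
Proof. by []. Qed.

Lemma sat_Eq (t u : term L n) : sat (Eq t u) e <-> eval e t = eval e u.
Proof. by []. Qed.

Lemma sat_All (f : form L n.+1) :
  sat (All f) e <-> forall x, sat f (snoc e x).
Proof. by []. Qed.

Lemma sat_Top : sat Top e <-> True. Proof. by split=> // _. Qed.

Lemma sat_And (f g : form L n) : sat (And f g) e <-> sat f e /\ sat g e.
Proof.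
split=> /= [H|[Hf Hg] H]; last exact: H.
by split; apply: contrapT => N; apply: H.
Qed.

Lemma sat_Or (f g : form L n) : sat (Or f g) e <-> sat f e \/ sat g e.
Proof.
split=> /= [H|[Hf|Hg] N //].
by case: (pselect (sat f e)) => Hf; [left|right; apply: H].
Qed.

Lemma sat_Ex (f : form L n.+1) : sat (Ex f) e <-> exists x, sat f (snoc e x).
Proof.
split=> /= [H|[x Hx] H]; last exact: H Hx.
by apply: contrapT => N; apply: H => x Hx; apply: N; exists x.
Qed.

Lemma sat_bigAnd (I : finType) (P : pred I) (F : I -> form L n) :
  sat (\big[@And L n/Top]_(i | P i) F i) e <-> forall i, P i -> sat (F i) e.
Proof.
suff H (r : seq I) : sat (\big[@And L n/Top]_(i <- r | P i) F i) e <->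
    forall i, i \in r -> P i -> sat (F i) e.
  rewrite H; split=> H' i; last by move=> _; apply: H'.
  exact: (H' i (mem_index_enum i)).
elim: r => [|i r IH]; first by rewrite big_nil; split=> // _ [].
rewrite big_cons; case: ifP => Pi.
  rewrite sat_And IH; split=> [[Hi Hr] j|H].
    by rewrite inE => /orP[/eqP ->//|]; apply: Hr.
  by split=> [|j jr]; apply: H; rewrite // inE ?eqxx // jr orbT.
rewrite IH; split=> H j jr Pj; last by apply: H; rewrite // inE jr orbT.
by move: jr; rewrite inE => /orP[/eqP ji|jr]; [rewrite -ji Pj in Pi|apply: H].
Qed.

Lemma sat_bigOr (I : finType) (F : I -> form L n) :
  sat (\big[@Or L n/Bot]_i F i) e <-> exists i, sat (F i) e.
Proof.
suff H (r : seq I) : sat (\big[@Or L n/Bot]_(i <- r) F i) e <->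
    exists2 i, i \in r & sat (F i) e.
  rewrite H; split=> [[i _ Hi]|[i Hi]]; first by exists i.
  exact: (ex_intro2 _ _ i (mem_index_enum i) Hi).
elim: r => [|i r IH]; first by rewrite big_nil; split=> // -[].
rewrite big_cons sat_Or IH; split=> [[Hi|[j jr Hj]]|[j]].
- by exists i; rewrite // inE eqxx.
- by exists j; rewrite // inE jr orbT.
- by rewrite inE => /orP[/eqP -> Hi|jr Hj]; [left|right; exists j].
Qed.

End Sat.

Lemma holds_close (L : language) (M : structure L) n (f : form L n) :
  holds M (close f) <-> forall e : 'I_n -> M, sat f e.
Proof.
elim: n f => [|n IH] f /=.
  by split=> [H e|]; [rewrite (env0E e)|apply].
rewrite IH /=; split=> H e; last by move=> x; apply: H.
by rewrite -(snocE e); apply: H.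
Qed.

Lemma holds_close_ex (L : language) (M : structure L) n (f : form L n) :
  holds M (close_ex f) <-> exists e : 'I_n -> M, sat f e.
Proof.
elim: n f => [|n IH] f /=.
  by split=> [H|[e]]; [exists (@env0 M)|rewrite (env0E e)].
rewrite IH; split=> [[e /sat_Ex[x Hx]]|[e He]]; first by exists (snoc e x).
exists (fun i => e (lift ord_max i)); apply/sat_Ex.
by exists (e ord_max); rewrite snocE.
Qed.

Section MeaningE.
Variables (L : og_language) (M : structure (lang_e L)).
Let P := @P_of L M.
Let E := @E_of L M.

Lemma tnth1_map (A B : Type) (g : A -> B) (x : A) :
  (fun i => g (tnth [tuple x] i)) = tnth [tuple g x].
Proof. by apply: funext => i; rewrite [i]ord1 !tnth0. Qed.

Lemma tnth2_map (A B : Type) (g : A -> B) (x y : A) :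
  (fun i => g (tnth [tuple x; y] i)) = tnth [tuple g x; g y].
Proof. by apply: funext => -[[|[|//]] ?]. Qed.

Lemma sat_fP n (e : 'I_n -> M) t : sat (fP t) e <-> P (eval e t).
Proof. by rewrite /= tnth1_map. Qed.

Lemma sat_fE n (e : 'I_n -> M) t u :
  sat (fE t u) e <-> E (eval e t) (eval e u).
Proof. by rewrite /= tnth2_map. Qed.

Lemma sat_fbetween n (e : 'I_n -> M) t u w :
  sat (fbetween t u w) e <->
  @open_interval L (reduct M) (Some (eval e t)) (Some (eval e w)) (eval e u).
Proof. by rewrite sat_And /= !tnth2_map. Qed.

Lemma snoc_last (A : Type) n (e : 'I_n -> A) x (h : n < n.+1) :
  snoc e x (Ordinal h) = x.
Proof.
by rewrite (_ : Ordinal h = ord_max) ?snoc_max //; apply: val_inj.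
Qed.

Lemma snoc_old (A : Type) n (e : 'I_n -> A) x i (h : i < n.+1) (h' : i < n) :
  snoc e x (Ordinal h) = e (Ordinal h').
Proof.
rewrite (_ : Ordinal h = lift ord_max (Ordinal h')) ?snoc_lift //.
by apply: val_inj; rewrite /= /bump leqNgt h'.
Qed.

#[local] Arguments sat : simpl never.

Lemma holds_P_dense : holds M (P_dense L) <-> dense_in setT P.
Proof.
have old0 x (e : 'I_2 -> M) : snoc e x (@Ordinal 3 0 isT) = e (@Ordinal 2 0 isT).
  exact: snoc_old.
have old1 x (e : 'I_2 -> M) : snoc e x (@Ordinal 3 1 isT) = e (@Ordinal 2 1 isT).
  exact: snoc_old.
rewrite holds_close; split=> [H a b [x [_ Hx]]|H e].
  have: @sat _ M 2 (Ex (fbetween 'v_0 'v_2 'v_1)) (tnth [tuple a; b]).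
    by apply/sat_Ex; exists x; apply/sat_fbetween; rewrite /= old0 old1 snoc_last.
  have /sat_Imp K := H (tnth [tuple a; b]).
  move=> /K/sat_Ex[y]; rewrite sat_And sat_fP sat_fbetween /= old0 old1 snoc_last => Hy.
  by exists y.
apply/sat_Imp => /sat_Ex[x]; rewrite sat_fbetween /= old0 old1 snoc_last => Hx.
have [|y Hy] := H (e (@Ordinal 2 0 isT)) (e (@Ordinal 2 1 isT)).
  by exists x; split.
apply/sat_Ex; exists y.
by rewrite sat_And sat_fP sat_fbetween /= old0 old1 snoc_last.
Qed.

Lemma holds_class_dense : holds M (class_dense L) <->
  forall c, P c -> dense_in P [set x | E c x].
Proof.
have old0 x (e : 'I_3 -> M) : snoc e x (@Ordinal 4 0 isT) = e (@Ordinal 3 0 isT).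
  exact: snoc_old.
have old1 x (e : 'I_3 -> M) : snoc e x (@Ordinal 4 1 isT) = e (@Ordinal 3 1 isT).
  exact: snoc_old.
have old2 x (e : 'I_3 -> M) : snoc e x (@Ordinal 4 2 isT) = e (@Ordinal 3 2 isT).
  exact: snoc_old.
rewrite holds_close; split=> [H c Pc a b [x [Px Hx]]|H e].
  have HP : @sat _ M 3 (fP 'v_0) (tnth [tuple c; a; b]) by exact/sat_fP.
  have: @sat _ M 3 (Ex (And (fP 'v_3) (fbetween 'v_1 'v_3 'v_2)))
            (tnth [tuple c; a; b]).
    apply/sat_Ex; exists x.
    by rewrite sat_And sat_fP sat_fbetween /= old1 old2 snoc_last.
  have /sat_Imp/(_ HP)/sat_Imp K := H (tnth [tuple c; a; b]).
  move=> /K/sat_Ex[y].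
  rewrite sat_And sat_fE sat_fbetween /= old0 old1 old2 snoc_last => Hy.
  by exists y.
apply/sat_Imp => /sat_fP Pc; apply/sat_Imp => /sat_Ex[x].
rewrite sat_And sat_fP sat_fbetween /= old1 old2 snoc_last => -[Px Hx].
have [|y Hy] := H _ Pc (e (@Ordinal 3 1 isT)) (e (@Ordinal 3 2 isT)).
  by exists x; split.
apply/sat_Ex; exists y.
by rewrite sat_And sat_fE sat_fbetween /= old0 old1 old2 snoc_last.
Qed.

Lemma holds_P_indep :
  (forall n (f : form L n.+1), holds M (P_indep f)) <->
  @dcl_independent L (reduct M) P.
Proof.
split=> [H s Ps [n [f [a [aP sE]]]]|H n f].
  pose e : 'I_n.+1 -> M := snoc a s.
  have fs : @sat L (reduct M) _ f e by move/seteqP: sE => [/(_ s erefl)].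
  have HP : sat (\big[@And _ _/Top]_(i < n.+1) fP (Var i)) e.
    apply/sat_bigAnd => i _; apply/sat_fP; rewrite /= /e.
    case: (unliftP ord_max i) => [j|] ->; last by rewrite snoc_max.
    by rewrite snoc_lift; have [] := aP j.
  have HN : sat (\big[@And _ _/Top]_(i < n)
      Not (Eq (Var (lift ord_max i)) (Var ord_max))) e.
    apply/sat_bigAnd => i _; apply/sat_Not; rewrite sat_Eq /= /e.
    by rewrite snoc_lift snoc_max; have [] := aP i.
  have /holds_close/(_ e)/sat_Imp/(_ HP)/sat_Imp/(_ HN)/sat_Imp K := H n f.
  have /K/sat_Ex[y] : sat (embed f) e by apply/sat_embed.
  rewrite sat_And sat_embed sat_rename sat_Not sat_Eq /= => -[].
  rewrite /e snoc_lift !snoc_max snoc_rename_up.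
  have -> : snoc a s \o lift ord_max = a :> ('I_n -> M).
    by apply: funext => i /=; rewrite snoc_lift.
  by move=> fy; apply; move/seteqP: sE => [_ /(_ y)]; apply.
apply/holds_close => e; rewrite -(snocE e).
move: (e ord_max) (fun i => e (lift ord_max i)) => s a {e}.
apply/sat_Imp => /sat_bigAnd eP; apply/sat_Imp => /sat_bigAnd eN.
apply/sat_Imp => /sat_embed fs.
have Ps : P s by have /sat_fP := eP ord_max isT; rewrite /= snoc_max.
apply: contrapT => N; apply: (H s Ps).
exists n, f, a; split=> [i|].
  split; first by have /sat_fP := eP (lift ord_max i) isT; rewrite /= snoc_lift.
  by have /sat_Not := eN i isT; rewrite sat_Eq /= snoc_lift snoc_max.
apply/seteqP; split=> [y ->|y /= fy] //.
apply: contrapT => ys; apply: N; apply/sat_Ex; exists y.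
rewrite sat_And sat_embed sat_rename sat_Not sat_Eq /=.
rewrite snoc_lift !snoc_max snoc_rename_up.
have -> // : snoc a s \o lift ord_max = a :> ('I_n -> M).
by apply: funext => i /=; rewrite snoc_lift.
Qed.

Lemma models_T2 : models M (@T2_axiom L) <->
  [/\ forall x y, E x y -> P x /\ P y, forall x, P x -> E x x,
      forall x y, E x y -> E y x & forall x y z, E x y -> E y z -> E x z].
Proof.
split=> [H|[H1 H2 H3 H4] _ []].
- split=> [x y|x|x y|x y z].
  + have /holds_close/(_ (tnth [tuple x; y])) := H _ (T2_sub L).
    by move=> /sat_Imp K /(sat_fE (tnth [tuple x; y]) 'v_0 'v_1)/K/sat_And[/sat_fP ? /sat_fP].
  + have /holds_close/(_ (tnth [tuple x])) := H _ (T2_refl L).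
    by move=> /sat_Imp K /(sat_fP (tnth [tuple x]) 'v_0)/K/sat_fE.
  + have /holds_close/(_ (tnth [tuple x; y])) := H _ (T2_sym L).
    by move=> /sat_Imp K /(sat_fE (tnth [tuple x; y]) 'v_0 'v_1)/K/sat_fE.
  + have /holds_close/(_ (tnth [tuple x; y; z])) := H _ (T2_trans L).
    move=> /sat_Imp K /(sat_fE (tnth [tuple x; y; z]) 'v_0 'v_1)/K/sat_Imp K'.
    by move=> /(sat_fE (tnth [tuple x; y; z]) 'v_1 'v_2)/K'/sat_fE.
- by apply/holds_close => e; apply/sat_Imp => /sat_fE/H1[? ?]; apply/sat_And; split; apply/sat_fP.
- by apply/holds_close => e; apply/sat_Imp => /sat_fP/H2 ?; apply/sat_fE.
- by apply/holds_close => e; apply/sat_Imp => /sat_fE/H3 ?; apply/sat_fE.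
- apply/holds_close => e; apply/sat_Imp => /sat_fE/H4 K.
  by apply/sat_Imp => /sat_fE/K ?; apply/sat_fE.
Qed.

Lemma sat_inequivalent n (e : 'I_n -> M) : sat (inequivalent L n) e <->
  (forall i, P (e i)) /\ (forall i j, i != j -> ~ E (e i) (e j)).
Proof.
rewrite sat_And !sat_bigAnd; split=> -[H1 H2]; split=> i.
- by have /sat_fP := H1 i isT.
- move=> j ij; have /sat_bigAnd/(_ j ij)/sat_Not K := H2 i isT.
  by move=> Eij; apply: K; apply/sat_fE.
- by move=> _; apply/sat_fP; apply: H1.
- by move=> _; apply/sat_bigAnd => j ij; apply/sat_Not => /sat_fE; apply: H2.
Qed.

Lemma holds_at_least_classes n : holds M (at_least_classes L n) <->
  exists e : 'I_n -> reduct M,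
    (forall i, P (e i)) /\ (forall i j, i != j -> ~ E (e i) (e j)).
Proof.
by rewrite holds_close_ex; split=> -[e /sat_inequivalent He]; exists e.
Qed.

Lemma holds_exactly_classes n : holds M (exactly_classes L n) <->
  exists e : 'I_n -> reduct M,
    [/\ forall i, P (e i), forall i j, i != j -> ~ E (e i) (e j)
       & forall x, P x -> exists i, E (e i) x].
Proof.
rewrite holds_close_ex; split=> -[e].
  rewrite sat_And => -[/sat_inequivalent[H1 H2] /sat_All H3]; exists e; split=> // x Px.
  have: sat (fP (Var ord_max)) (snoc e x) by apply/sat_fP; rewrite /= snoc_max.
  have /sat_Imp K := H3 x; move=> /K/sat_bigOr[i /sat_fE].
  by rewrite /= snoc_lift snoc_max => ?; exists i.
move=> [H1 H2 H3]; exists e; apply/sat_And; split; first exact/sat_inequivalent.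
apply/sat_All => x; apply/sat_Imp => /sat_fP; rewrite /= snoc_max => /H3[i Hi].
by apply/sat_bigOr; exists i; apply/sat_fE; rewrite /= snoc_lift snoc_max.
Qed.

Lemma models_Te (T : theory L) : models M (Te T) <->
  [/\ models (reduct M) T, dense_in setT P, @dcl_independent L (reduct M) P,
      models M (@T2_axiom L) & forall c, P c -> dense_in P [set x | E c x]].
Proof.
split=> [H|[H1 H2 H3 H4 H5] f [[[[g Tg <-]|[|n g]]|]|->]].
- split.
  + move=> f Tf; apply/sat_embed; apply: H.
    by left; left; left; exists f.
  + by apply/holds_P_dense; apply: H; left; left; right; constructor.
  + by apply/holds_P_indep => n f; apply: H; left; left; right; constructor.
  + by move=> f Hf; apply: H; left; right.
  + by apply/holds_class_dense; apply: H; right.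
- exact/sat_embed/H1.
- exact/holds_P_dense.
- exact: (holds_P_indep.2 H3).
- exact: H4.
- exact/holds_class_dense.
Qed.

End MeaningE.

End Meaning.

(* Main.v *)
(* Completeness is a back-and-forth argument between tuples a and b of two models that
   have the same L-type and the same P- and E-relations and over which the remaining
   elements of P are independent.  A new element of P is matched because every class
   meets every interval; an element of dcl(a, P) is reached through finitely many
   elements of P.  For an element outside dcl(a, P) one needs codensity: the sum of
   m+1 elements of P is not definable from b and m elements of P, since each summand
   is definable from the sum and the other summands, and such sums meet every interval.
   Instead of working in saturated models, one model is replaced by an elementary
   extension at each step, and the induction is on formulas, for all models at once.

   For consistency, elements of P are named by well-founded trees: a node names a
   point of prescribed colour in an interval whose ends are definable over the points
   named by its children.  By compactness the names get values, each outside the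
   definable closure of the values of smaller names for a well-order refining the rank.
   By the exchange property all values are independent, and their definable closure is
   the required model: it is an elementary submodel because a definable set either
   meets it or contains an interval with ends in it. *)

Require Import Defs.
From mathcomp Require Import all_boot.
From mathcomp Require Import boolp classical_sets.
From mathcomp Require Import filter.
From mathcomp Require wochoice.
From Stdlib Require List.

Set Implicit Arguments.
Unset Strict Implicit.
Unset Printing Implicit Defensive.

Local Open Scope classical_set_scope.

(** * Ultrapowers and compactness *)

Definition elementary (K : language) (M N : structure K) (j : M -> N) : Prop :=
  forall n (f : form K n) (e : 'I_n -> M), sat f e <-> sat f (fun i => j (e i)).

Lemma map_snoc (A B : Type) (g : A -> B) n (e : 'I_n -> A) x :
  (fun i => g (snoc e x i)) = snoc (fun i => g (e i)) (g x).
Proof.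
by apply: funext => i; case: (unliftP ord_max i) => [k|] ->;
  rewrite ?snoc_lift ?snoc_max.
Qed.

Section Ultrapower.
Variables (K : language) (M : structure K) (J : Type) (U : set_system J).
Hypothesis UU : UltraFilter U.

Let U_filter : Filter U := @filter_filter _ _ (@ultra_proper _ _ UU).
#[local] Existing Instance U_filter.

Definition eq_ae (f g : J -> M) : Prop := U [set i | f i = g i].

Lemma eq_ae_sym f g : eq_ae f g -> eq_ae g f.
Proof. by apply: filterS => i /= ->. Qed.

Lemma eq_ae_trans f g h : eq_ae f g -> eq_ae g h -> eq_ae f h.
Proof. by apply: filterS2 => i /= -> ->. Qed.

Definition ultra_carrier := {X : set (J -> M) | exists f, X = eq_ae f}.

Definition ultra_class (f : J -> M) : ultra_carrier :=
  exist _ (eq_ae f) (ex_intro _ f erefl).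

Definition ultra_repr (X : ultra_carrier) : J -> M := projT1 (cid (proj2_sig X)).

Lemma ultra_reprK X : ultra_class (ultra_repr X) = X.
Proof. by case: X => X p; apply: eq_exist; rewrite /ultra_repr; case: cid. Qed.

Lemma ultra_class_eq f g : ultra_class f = ultra_class g <-> eq_ae f g.
Proof.
split=> [[H]|H].
  have : eq_ae g g by apply: filterS filterT => i.
  by rewrite -{1}H.
apply: eq_exist; apply/seteqP; split=> h /= k.
  exact: eq_ae_trans (eq_ae_sym H) k.
exact: eq_ae_trans H k.
Qed.

Lemma ultra_repr_class f : eq_ae (ultra_repr (ultra_class f)) f.
Proof. by apply/ultra_class_eq; rewrite ultra_reprK. Qed.

(** Operations and relations are computed on chosen representatives, which by [ultra_repr_class]
    agree almost everywhere with any others. *)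
Definition ultrapower : structure K :=
  Structure
    (fun k c args => ultra_class (fun i => fun_of M c (fun a => ultra_repr (args a) i)))
    (fun k r args => U [set i | rel_of M r (fun a => ultra_repr (args a) i)]).

Lemma eval_ultrapower n (e : 'I_n -> ultrapower) (t : term K n) :
  eval e t = ultra_class (fun i => eval (fun a => ultra_repr (e a) i) t).
Proof.
elim: t => [a|k c ts IH] /=; first by rewrite ultra_reprK.
apply/ultra_class_eq.
have : U [set i | forall a, ultra_repr (eval e (ts a)) i =
                 eval (fun b => ultra_repr (e b) i) (ts a)].
  by apply: filter_forall => a; rewrite IH; apply: ultra_repr_class.
by apply: filterS => i /= H; congr fun_of; apply: funext.
Qed.

(** This is the theorem of Los. An ultrafilter contains each set or its complement, which settles
    implications; for a quantifier, counterexamples chosen at the failing coordinates form a single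
    counterexample [g] in the ultrapower. *)
Lemma sat_ultrapower n (f : form K n) (e : 'I_n -> ultrapower) :
  sat f e <-> U [set i | sat f (fun a => ultra_repr (e a) i)].
Proof.
elim: f e => [{}n|{}n t u|{}n k r ts|{}n f IHf g IHg|{}n f IHf] e /=.
- by split=> // H; have [i []] := @filter_ex _ U _ _ H.
- by rewrite !eval_ultrapower ultra_class_eq.
- have R : U [set i | forall a, ultra_repr (eval e (ts a)) i =
                 eval (fun b => ultra_repr (e b) i) (ts a)].
    apply: filter_forall => a /=; rewrite (eval_ultrapower e); exact: ultra_repr_class.
  by split; apply: filterS2 R => i /= /funext ->.
- rewrite IHf IHg; split=> H; last by apply: filterS2 H => i /=; apply.
  have [Uf|Uf] := in_ultra_setVsetC [set i | sat f (fun a => ultra_repr (e a) i)] UU.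
    by apply: (filterS _ (H Uf)) => i /= ? _.
  by apply: (filterS _ Uf) => i /= nf /nf.
- split=> H; last first.
    by move=> X; apply/IHf; apply: filterS H => i /= H;
    rewrite (map_snoc (fun Y => ultra_repr Y i)); apply: H.
  set A := [set i | _]; have [//|UA] := in_ultra_setVsetC A UU.
  (* A carrier may be empty; here a failing coordinate supplies the default value that [g] takes at
     the other coordinates. *)
  have [x0 _] : exists x : M, True.
    have [i /= Ai] := @filter_ex _ U _ _ UA.
    by apply: contrapT => Mx; apply: Ai => x; case: Mx; exists x.
  have /choice[g gP] : forall i, exists x, ~ A i ->
      ~ sat f (snoc (fun a => ultra_repr (e a) i) x).
    move=> i; case: (pselect (A i)) => [Ai|/existsNP[x Hx]]; last by exists x.
    by exists x0.
  have /IHf Ug := H (ultra_class g).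
  have [i /= []] := @filter_ex _ U _ _ (filterI UA (filterI Ug (ultra_repr_class g))).
  by move=> /gP Ng [Ug' gi]; case: Ng; rewrite (map_snoc (fun Y => ultra_repr Y i)) gi in Ug'.
Qed.

End Ultrapower.

Section Compactness.
Variables (K : language) (M : structure K) (I : Type).

(* A condition is a formula whose variables are assigned elements of [M] and
   unknowns from [I]. *)
Definition condition := {n : nat & (form K n * ('I_n -> M + I))%type}.

Definition meets (N : structure K) (j : M -> N) (h : I -> N) (c : condition) : Prop :=
  sat (projT2 c).1
    (fun i => match (projT2 c).2 i with inl x => j x | inr v => h v end).

(** The ultrapower is indexed by the finite lists of conditions, along an ultrafilter containing for
    each list the set of its extensions. The solutions [H l] of the single lists form one solution,
    and [M] embeds by constant functions. *)
Theorem compactness (S : set condition) :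
  (forall l : seq condition, exists h : I -> M,
     forall c, List.In c l -> S c -> meets id h c) ->
  exists (N : structure K) (j : M -> N), elementary j /\
    exists h : I -> N, forall c, S c -> meets j h c.
Proof.
move=> /choice[H HP].
pose F : set_system (seq condition) :=
  filter_from setT (fun l0 => [set l | forall c, List.In c l0 -> List.In c l]).
have FF : ProperFilter F.
  apply: filter_from_proper; last by move=> l _; exists l.
  apply: filter_fromT_filter; first by exists [::].
  move=> l1 l2; exists (l1 ++ l2) => l /= Hl.
  by split=> c cl; apply: Hl; apply/List.in_or_app; [left|right].
have [U [UU FU]] := ultraFilterLemma FF.
have UF : Filter U := @filter_filter _ _ (@ultra_proper _ _ UU).
exists (ultrapower M U), (fun x => ultra_class U (fun=> x)); split.
  move=> n f e; rewrite sat_ultrapower; split=> [fe|Uf].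
    have : U [set i | forall a, ultra_repr (ultra_class U (fun=> e a)) i = e a].
      by apply: filter_forall => a; apply: ultra_repr_class.
    by apply: filterS => i /= /funext ->.
  have Ue : U [set i | forall a, ultra_repr (ultra_class U (fun=> e a)) i = e a].
    by apply: filter_forall => a; apply: ultra_repr_class.
  by have [i /= [fi /funext <-]] := filter_ex (filterI Uf Ue).
exists (fun v => ultra_class U (H ^~ v)) => -[n [f e]] Sc.
rewrite /meets /= sat_ultrapower.
have Uc : U [set l | List.In (existT _ n (f, e)) l].
  by apply: FU; exists [:: existT _ n (f, e)] => // l; apply; left.
have Ue : U [set l | forall a, ultra_repr (match e a with
      inl x => ultra_class U (fun=> x) | inr v => ultra_class U (H ^~ v) end) l
      = match e a with inl x => x | inr v => H l v end].
  by apply: filter_forall => a; case: (e a) => ?; apply: ultra_repr_class.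
by apply: filterS2 Uc Ue => l /= /HP/(_ Sc) Hl /funext ->.
Qed.

End Compactness.

(** * Concatenation of tuples *)

Definition cat_env (A : Type) n m (a : 'I_n -> A) (b : 'I_m -> A) (i : 'I_(n + m)) : A :=
  match split i with inl j => a j | inr k => b k end.

Lemma cat_lshift (A : Type) n m (a : 'I_n -> A) (b : 'I_m -> A) i :
  cat_env a b (lshift m i) = a i.
Proof. by rewrite /cat_env -[lshift m i]/(unsplit (inl i)) unsplitK. Qed.

Lemma cat_rshift (A : Type) n m (a : 'I_n -> A) (b : 'I_m -> A) i :
  cat_env a b (rshift n i) = b i.
Proof. by rewrite /cat_env -[rshift n i]/(unsplit (inr i)) unsplitK. Qed.

Lemma map_cat (A B : Type) (g : A -> B) n m (a : 'I_n -> A) (b : 'I_m -> A) :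
  (fun i => g (cat_env a b i)) = cat_env (fun i => g (a i)) (fun i => g (b i)).
Proof. by apply: funext => i; rewrite /cat_env; case: split. Qed.

Lemma snoc_eta (A : Type) n (e : 'I_n -> A) x :
  (fun i => snoc e x (lift ord_max i)) = e.
Proof. by apply: funext => i; rewrite snoc_lift. Qed.

Lemma cat_eta1 (A : Type) n m (a : 'I_n -> A) (b : 'I_m -> A) :
  (fun i => cat_env a b (lshift m i)) = a.
Proof. by apply: funext => i; rewrite cat_lshift. Qed.

Lemma cat_eta2 (A : Type) n m (a : 'I_n -> A) (b : 'I_m -> A) :
  (fun i => cat_env a b (rshift n i)) = b.
Proof. by apply: funext => i; rewrite cat_rshift. Qed.

(** This turns parameters from a union into [a] itself followed by finitely many elements of [B], so
    that formulas can be renamed to [cat_env a q]. *)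
Lemma env_split (A : Type) n (a : 'I_n -> A) (B : set A) m (d : 'I_m -> A) :
  (forall i, (range a `|` B) (d i)) ->
  exists k (q : 'I_k -> A) (s : 'I_m -> 'I_(n + k)),
    (forall i, B (q i)) /\ forall i, d i = cat_env a q (s i).
Proof.
move=> dAB; case: (pselect (exists i, B (d i))) => [[i0 Bi0]|nB].
  (* Entries outside [B] are replaced by the entry [d i0], which keeps the whole tuple in [B]. *)
  exists m, (fun i => if pselect (B (d i)) then d i else d i0).
  have /choice[s sP] : forall i, exists k : 'I_(n + m), d i = cat_env a
      (fun i => if pselect (B (d i)) then d i else d i0) k.
    move=> i; case: (pselect (B (d i))) => Bi.
      by exists (rshift n i); rewrite cat_rshift; case: pselect.
    by case: (dAB i) => // -[k _ <-]; exists (lshift m k); rewrite cat_lshift.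
  by exists s; split=> // i; case: pselect.
have /choice[s sP] : forall i, exists k : 'I_(n + 0), d i = cat_env a (@env0 A) k.
  move=> i; case: (dAB i) => [[k _ <-]|Bi]; last by case: nB; exists i.
  by exists (lshift 0 k); rewrite cat_lshift.
by exists 0, (@env0 A), s; split=> // -[].
Qed.

(** * Uniformly definable relations *)

(** One formula serves all structures. A relation written in ordinary logic can thus be transferred
    along [elementary] or [similar] without its formula being spelled out. *)
Definition udef (K : language) n (R : forall M : structure K, ('I_n -> M) -> Prop) :=
  exists f : form K n, forall M e, sat f e <-> R M e.

Section UniformlyDefinable.
Variable K : language.
Implicit Types n m : nat.

Lemma udef_rename m n (R : forall M : structure K, ('I_m -> M) -> Prop) (s : 'I_m -> 'I_n) :
  udef R -> udef (fun M e => R M (fun i => e (s i))).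
Proof. by move=> [f fR]; exists (rename f s) => M e; rewrite sat_rename fR. Qed.

Lemma udef_sat m n (f : form K m) (s : 'I_m -> 'I_n) :
  udef (fun M e => sat (M := M) f (fun i => e (s i))).
Proof. by apply: (udef_rename (R := fun M e => sat (M := M) f e)); exists f. Qed.

Lemma udef_snoc m n (f : form K m.+1) (s : 'I_m -> 'I_n) k :
  udef (fun M e => sat (M := M) f (snoc (fun i => e (s i)) (e k))).
Proof.
have [g gP] := udef_sat f (snoc s k); exists g => M e.
by rewrite gP map_snoc.
Qed.

Lemma udef_snoc_cat m1 m2 n (f : form K (m1 + m2).+1) (s1 : 'I_m1 -> 'I_n)
    (s2 : 'I_m2 -> 'I_n) k :
  udef (fun M e => sat (M := M) f
    (snoc (cat_env (fun i => e (s1 i)) (fun i => e (s2 i))) (e k))).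
Proof.
have [g gP] := udef_snoc f (cat_env s1 s2) k; exists g => M e.
by rewrite gP map_cat.
Qed.

Lemma udef_eq n (i j : 'I_n) : udef (fun (M : structure K) e => e i = e j).
Proof. by exists (Eq (Var i) (Var j)). Qed.

Section Connectives.
Variables (n : nat) (R S : forall M : structure K, ('I_n -> M) -> Prop).
#[local] Arguments R : clear implicits.
#[local] Arguments S : clear implicits.

Lemma udef_imp : udef R -> udef S -> udef (fun M e => R M e -> S M e).
Proof. by move=> [f fR] [g gS]; exists (Imp f g) => M e /=; rewrite fR gS. Qed.

Lemma udef_not : udef R -> udef (fun M e => ~ R M e).
Proof. by move=> [f fR]; exists (Not f) => M e /=; rewrite fR. Qed.

Lemma udef_and : udef R -> udef S -> udef (fun M e => R M e /\ S M e).
Proof. by move=> [f fR] [g gS]; exists (And f g) => M e; rewrite sat_And fR gS. Qed.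

Lemma udef_or : udef R -> udef S -> udef (fun M e => R M e \/ S M e).
Proof. by move=> [f fR] [g gS]; exists (Or f g) => M e; rewrite sat_Or fR gS. Qed.

Lemma udef_iff : udef R -> udef S -> udef (fun M e => R M e <-> S M e).
Proof.
move=> [f fR] [g gS]; exists (And (Imp f g) (Imp g f)) => M e.
by rewrite sat_And /= fR gS.
Qed.

Lemma udef_true : udef (fun (M : structure K) (e : 'I_n -> M) => True).
Proof. by exists Top => M e; rewrite sat_Top. Qed.

End Connectives.

Lemma udef_fin (I : finType) n (R : I -> forall M : structure K, ('I_n -> M) -> Prop) :
  (forall i, udef (R i)) -> udef (fun M e => forall i, R i M e).
Proof.
move=> /choice[f fR]; exists (\big[@And _ _/Top]_i f i) => M e.
rewrite sat_bigAnd; split=> H i; first by rewrite -fR; apply: H.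
by rewrite fR.
Qed.

Lemma udef_all n (R : forall M : structure K, ('I_n -> M) -> M -> Prop) :
  udef (n := n.+1) (fun M e => R M (fun i => e (lift ord_max i)) (e ord_max)) ->
  udef (fun M e => forall x, R M e x).
Proof.
move=> [f fR]; exists (All f) => M e; rewrite sat_All; split=> H x.
  by have := H x; rewrite fR snoc_eta snoc_max.
by rewrite fR snoc_eta snoc_max.
Qed.

Lemma udef_ex n (R : forall M : structure K, ('I_n -> M) -> M -> Prop) :
  udef (n := n.+1) (fun M e => R M (fun i => e (lift ord_max i)) (e ord_max)) ->
  udef (fun M e => exists x, R M e x).
Proof.
move=> [f fR]; exists (Ex f) => M e; rewrite sat_Ex; split=> -[x Hx]; exists x.
  by move: Hx; rewrite fR snoc_eta snoc_max.
by rewrite fR snoc_eta snoc_max.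
Qed.

Lemma udef_alln n m (R : forall M : structure K, ('I_n -> M) -> ('I_m -> M) -> Prop) :
  udef (n := n + m)
    (fun M e => R M (fun i => e (lshift m i)) (fun i => e (rshift n i))) ->
  udef (fun M e => forall q, R M e q).
Proof.
elim: m n R => [|m IH] n R RU.
  have [f fR] := udef_rename (cast_ord (addn0 n)) RU; exists f => M e.
  rewrite fR; have -> : (fun i => e (cast_ord (addn0 n) (lshift 0 i))) = e.
    by apply: funext => i; congr e; apply: val_inj.
  rewrite (env0E (fun i => e (cast_ord (addn0 n) (rshift n i)))).
  by split=> [H q|]; [rewrite (env0E q)|apply].
have [f fR] : udef (fun (M : structure K) (e : 'I_n -> M) => forall x q, R M e (snoc q x)).
  apply: udef_all; apply: IH.
  have [f fR] := udef_rename (cat_env (fun i => lshift m (lift ord_max i))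
     (snoc (fun j : 'I_m => rshift n.+1 j) (lshift m ord_max))) RU.
  exists f => M e; rewrite fR.
  have RE a a' b b' : a = a' -> b = b' -> R M a b <-> R M a' b' by move=> -> ->.
  apply: RE; apply: funext => i; first by rewrite cat_lshift.
  rewrite cat_rshift; exact: (congr1 (@^~ i) (map_snoc e _ _)).
exists f => M e; rewrite fR; split=> H; last by move=> x q; apply: H.
by move=> q; rewrite -(snocE q).
Qed.

Lemma udef_exn n m (R : forall M : structure K, ('I_n -> M) -> ('I_m -> M) -> Prop) :
  udef (n := n + m)
    (fun M e => R M (fun i => e (lshift m i)) (fun i => e (rshift n i))) ->
  udef (fun M e => exists q, R M e q).
Proof.
move=> RU; have [f fR] := udef_not (udef_alln (R := fun M e q => ~ R M e q) (udef_not RU)).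
exists f => M e; rewrite fR; split=> [/existsNP[q /contrapT Hq]|[q Hq] /(_ q)//].
by exists q.
Qed.

End UniformlyDefinable.

Ltac udef_step :=
  first [ apply: udef_all | apply: udef_ex | apply: udef_true | apply: udef_and
        | apply: udef_or | apply: udef_iff | apply: udef_not
        | apply: udef_imp | apply: udef_eq | apply: udef_sat
        | apply: udef_snoc | apply: udef_snoc_cat ].

(** * Definable closure *)

(** The parameters are a given tuple in a given order, so that sets derived from [X] can be shown
    definable over the same tuple. *)
Definition adef (K : language) (M : structure K) n (a : 'I_n -> M) (X : set M) : Prop :=
  exists f : form K n.+1, forall y, sat f (snoc a y) <-> X y.

Lemma udef_adef (K : language) n (R : forall M : structure K, ('I_n -> M) -> M -> Prop)
    (M : structure K) (a : 'I_n -> M) :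
  udef (n := n.+1) (fun M e => R M (fun i => e (lift ord_max i)) (e ord_max)) ->
  adef a (R M a).
Proof. by move=> [f fR]; exists f => y; rewrite fR snoc_eta snoc_max. Qed.

Section DefinableClosure.
Variables (K : language) (M : structure K).
Implicit Types A B : set M.

Lemma dclP A x : dcl A x <-> exists n (a : 'I_n -> M),
  (forall i, A (a i)) /\ adef a [set x].
Proof.
split=> [[n [f [a [aA /seteqP[s1 s2]]]]]|[n [a [aA [f fx]]]]].
  by exists n, a; split=> //; exists f => y; split; [apply: s2|apply: s1].
by exists n, f, a; split=> //; apply/seteqP; split=> y /fx.
Qed.

Lemma dcl_range n (a : 'I_n -> M) x : adef a [set x] -> dcl (range a) x.
Proof. by move=> ax; apply/dclP; exists n, a; split=> // i; exists i. Qed.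

Lemma dcl_mono A B : A `<=` B -> dcl A `<=` dcl B.
Proof. by move=> AB x /dclP[n [a [aA ax]]]; apply/dclP; exists n, a; split=> // i; apply: AB. Qed.

Lemma dcl_incl A : A `<=` dcl A.
Proof.
move=> x Ax; apply: (@dcl_mono (range (fun _ : 'I_1 => x))); first by move=> _ [_ _ <-].
apply: dcl_range; exists (Eq (Var ord_max) (Var ord0)) => y /=.
by rewrite snoc_max (_ : ord0 = lift ord_max (ord0 : 'I_1)) ?snoc_lift //; apply: val_inj.
Qed.

Lemma dcl_unionP n (a : 'I_n -> M) B x :
  dcl (range a `|` B) x <->
  exists k (q : 'I_k -> M), (forall i, B (q i)) /\ adef (cat_env a q) [set x].
Proof.
split=> [/dclP[m [d [dAB [f fx]]]]|[k [q [Bq ax]]]].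
  have [k [q [s [Bq dE]]]] := env_split dAB.
  exists k, q; split=> //.
  have [g gP] := @udef_adef K (n + k)
    (fun (N : structure K) e y => sat (M := N) f (snoc (fun i => e (s i)) y)) M
    (cat_env a q) (udef_snoc f (fun i => lift ord_max (s i)) ord_max).
  by exists g => y; rewrite gP -fx (_ : d = fun i => cat_env a q (s i)) //; apply: funext.
apply/dclP; exists (n + k)%N, (cat_env a q); split=> // i.
by rewrite /cat_env; case: split => j; [left; exists j|right].
Qed.

(** The definition [g] of [c] is substituted into the definition [f] of [x] by an existential
    quantifier. *)
Lemma dcl_cut A c x : dcl A c -> dcl (A `|` [set c]) x -> dcl A x.
Proof.
move=> /dclP[m [d [dA [g gc]]]].
rewrite setUC -[[set c]](_ : range (fun _ : 'I_1 => c) = _); last first.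
  by apply/seteqP; split=> [_ [_ _ <-]|_ ->] //; exists ord0.
move=> /dcl_unionP[k [q [qA [f fx]]]].
apply/dclP; exists (k + m)%N, (cat_env q d); split.
  by move=> i; rewrite /cat_env; case: split.
have [|h hP] := @udef_adef _ _ (fun (M : structure K) (e : 'I_(k + m) -> M) y => exists z,
    sat g (snoc (fun i => e (rshift k i)) z) /\
    sat f (snoc (cat_env (fun _ => z) (fun i => e (lshift m i))) y)) M (cat_env q d).
  by do 4!udef_step.
exists h => y; rewrite hP cat_eta1 cat_eta2 -fx; split=> [[z [/gc -> //]]|H].
by exists c; split=> //; apply/gc.
Qed.

(** The parameters defining [x] are adjoined to [A] and then removed one at a time by [dcl_cut]. *)
Lemma dcl_trans A B : B `<=` dcl A -> dcl B `<=` dcl A.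
Proof.
move=> BA x /dclP[n [a [aB /dcl_range ax]]].
have {B BA aB} aA : forall i, dcl A (a i) by move=> i; apply: BA.
have {ax} : dcl (A `|` range a) x by apply: dcl_mono ax => y; right.
elim: n a aA => [|n IH] a aA.
  by apply: dcl_mono => y [//|[[]]].
move=> H; apply: (IH (fun i => a (lift ord_max i))) => //.
apply: (@dcl_cut _ (a ord_max)); first by apply: dcl_mono (aA ord_max) => y; left.
apply: dcl_mono H => y [Ay|[i _ <-]]; first by left; left.
case: (unliftP ord_max i) => [k|] ->; last by right.
by left; right; exists k.
Qed.

Lemma dcl_fun A k (c : func_sym K k) (args : 'I_k -> M) :
  (forall i, dcl A (args i)) -> dcl A (fun_of M c args).
Proof.
move=> H; apply: (@dcl_trans A (range args)); first by move=> _ [i _ <-].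
apply: dcl_range; exists (Eq (Var ord_max) (App c (fun i => Var (lift ord_max i)))) => y /=.
by rewrite snoc_max (funext (fun i => snoc_lift args y i)).
Qed.

End DefinableClosure.

(** * O-minimal dense ordered groups *)

Notation "x <o y" := (lt_of x y) (at level 70, no associativity).

Section Terms.
Variables (L : og_language) (M : structure L).

Definition gzero : M := fun_of M (zero_sym L) (@env0 M).
Definition gone : M := fun_of M (one_sym L) (@env0 M).
Definition gadd (x y : M) : M := fun_of M (add_sym L) (tnth [tuple x; y]).
Definition gopp (x : M) : M := fun_of M (opp_sym L) (tnth [tuple x]).

Variables (n : nat) (e : 'I_n -> M).

Lemma eval_tzero : eval e (tzero L n) = gzero.
Proof. by congr fun_of; apply: env0E. Qed.

Lemma eval_tone : eval e (tone L n) = gone.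
Proof. by congr fun_of; apply: env0E. Qed.

Lemma eval_tadd (t u : term L n) : eval e (tadd t u) = gadd (eval e t) (eval e u).
Proof. by rewrite /= tnth2_map. Qed.

Lemma eval_topp (t : term L n) : eval e (topp t) = gopp (eval e t).
Proof. by rewrite /= tnth1_map. Qed.

Lemma sat_flt (t u : term L n) : sat (flt t u) e <-> eval e t <o eval e u.
Proof. by rewrite /= tnth2_map. Qed.

End Terms.

Lemma udef_lt (L : og_language) n (i j : 'I_n) :
  udef (fun (M : structure L) e => e i <o e j).
Proof. by exists (flt (Var i) (Var j)) => M e; rewrite sat_flt. Qed.

Record dense_og (L : og_language) (M : structure L) : Prop := DenseOg {
  gaddA : forall x y z : M, gadd x (gadd y z) = gadd (gadd x y) z;
  gadd0l : forall x : M, gadd (gzero M) x = x;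
  gadd0r : forall x : M, gadd x (gzero M) = x;
  gaddNl : forall x : M, gadd (gopp x) x = gzero M;
  gaddNr : forall x : M, gadd x (gopp x) = gzero M;
  lt_irr : forall x : M, ~ x <o x;
  lt_trans : forall x y z : M, x <o y -> y <o z -> x <o z;
  lt_total : forall x y : M, x <o y \/ x = y \/ y <o x;
  lt_add2l : forall x y z : M, x <o y -> gadd z x <o gadd z y;
  lt_add2r : forall x y z : M, x <o y -> gadd x z <o gadd y z;
  lt_dense : forall x y : M, x <o y -> exists2 z, x <o z & z <o y;
  lt01 : gzero M <o gone M }.

Lemma models_dense_og (L : og_language) (M : structure L) :
  models M (@dense_og_axiom L) -> dense_og M.
Proof.
move=> H; split.
- move=> x y z; have /holds_close/(_ (tnth [tuple x; y; z])) := H _ (og_addA L).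
  by rewrite sat_Eq !eval_tadd.
- move=> x; have /holds_close/(_ (tnth [tuple x])) := H _ (og_add0l L).
  by rewrite sat_Eq !eval_tadd eval_tzero.
- move=> x; have /holds_close/(_ (tnth [tuple x])) := H _ (og_add0r L).
  by rewrite sat_Eq !eval_tadd eval_tzero.
- move=> x; have /holds_close/(_ (tnth [tuple x])) := H _ (og_addNl L).
  by rewrite sat_Eq !eval_tadd eval_topp eval_tzero.
- move=> x; have /holds_close/(_ (tnth [tuple x])) := H _ (og_addNr L).
  by rewrite sat_Eq !eval_tadd eval_topp eval_tzero.
- move=> x; have /holds_close/(_ (tnth [tuple x])) := H _ (og_lt_irr L).
  by rewrite sat_Not sat_flt.
- move=> x y z; have /holds_close/(_ (tnth [tuple x; y; z])) := H _ (og_lt_trans L).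
  by rewrite !sat_Imp !sat_flt.
- move=> x y; have /holds_close/(_ (tnth [tuple x; y])) := H _ (og_lt_total L).
  by rewrite !sat_Or !sat_flt.
- move=> x y z; have /holds_close/(_ (tnth [tuple x; y; z])) := H _ (og_lt_add2l L).
  by rewrite !sat_Imp !sat_flt !eval_tadd.
- move=> x y z; have /holds_close/(_ (tnth [tuple x; y; z])) := H _ (og_lt_add2r L).
  by rewrite !sat_Imp !sat_flt !eval_tadd.
- move=> x y; have /holds_close/(_ (tnth [tuple x; y])) := H _ (og_lt_dense L).
  rewrite sat_Imp sat_flt sat_Ex => K /K[z].
  rewrite sat_And !sat_flt /= snoc_last => -[xz zy]; exists z.
    by move: xz; rewrite (@snoc_old _ 2 _ _ 0 isT isT).
  by move: zy; rewrite (@snoc_old _ 2 _ _ 1 isT isT).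
- by have := H _ (og_lt01 L); rewrite /holds sat_flt eval_tzero eval_tone.
Qed.

(** * Finite sets *)

(** This is finiteness, in a form for which subsets and unions are immediate. *)
Definition covered (A : Type) (X : set A) : Prop :=
  exists k (e : 'I_k -> A), X `<=` range e.

Lemma covered_sub (A : Type) (X Y : set A) : X `<=` Y -> covered Y -> covered X.
Proof. by move=> XY [k [e Ye]]; exists k, e => x /XY/Ye. Qed.

Lemma covered_union (A : Type) (X Y : set A) : covered X -> covered Y -> covered (X `|` Y).
Proof.
move=> [k [e Xe]] [m [d Yd]]; exists (k + m)%N, (cat_env e d) => x [/Xe[i _ <-]|/Yd[i _ <-]].
  by exists (lshift m i); rewrite // cat_lshift.
by exists (rshift k i); rewrite // cat_rshift.
Qed.

Lemma covered1 (A : Type) (x : A) : covered [set x].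
Proof. by exists 1%N, (fun=> x) => y ->; exists ord0. Qed.

Lemma covered0 (A : Type) : covered (@set0 A).
Proof. by exists 0%N, (@env0 A). Qed.

(** The strict order [R] is arbitrary because the lemma serves for the order of a structure, for its
    reverse and for the reversed order on names. *)
Lemma covered_minimal (A : Type) (R : A -> A -> Prop) (X : set A) :
  (forall x, ~ R x x) -> (forall x y z, R x y -> R y z -> R x z) ->
  covered X -> X !=set0 -> exists2 m, X m & forall z, X z -> ~ R z m.
Proof.
move=> Rirr Rtr [k [e]]; elim: k e X => [|k IH] e X Xe [x Xx].
  by have [[]] := Xe x Xx.
case: (pselect ((X `\ e ord_max) !=set0)) => [X'0|X'0]; last first.
  have XE z : X z -> z = e ord_max.
    by move=> Xz; apply: contrapT => ze; apply: X'0; exists z.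
  by exists x => // z /XE ->; rewrite (XE x Xx); apply: Rirr.
have X'e : X `\ e ord_max `<=` range (fun i => e (lift ord_max i)).
  move=> y [/Xe[i _ <-] ye]; case: (unliftP ord_max i) ye => [j -> _|-> []] //.
have [m [Xm me] mP] := IH _ _ X'e X'0.
case: (pselect (X (e ord_max) /\ R (e ord_max) m)) => [[Xe' eRm]|nR].
  exists (e ord_max) => // z Xz zRe.
  case: (pselect (z = e ord_max)) => [ze|ze]; first by rewrite ze in zRe; apply: Rirr zRe.
  by apply: (mP z); [split|apply: Rtr eRm].
exists m => // z Xz zRm; case: (pselect (z = e ord_max)) => ze.
  by apply: nR; rewrite -ze.
by apply: (mP z).
Qed.

(** * Interiors, boundaries and suprema in the order topology *)

Section OrderedGroup.
Variables (L : og_language) (M : structure L).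
Hypothesis MG : dense_og M.
Implicit Types (x y z u v r t : M) (X Y : set M).

Lemma lt_le_trans x y z : x <o y -> ~ z <o y -> x <o z.
Proof. by move=> xy zy; case: (lt_total MG y z) => [|[<- //|/zy//]]; apply: lt_trans xy. Qed.

Lemma le_lt_trans x y z : ~ y <o x -> y <o z -> x <o z.
Proof. by move=> yx yz; case: (lt_total MG x y) => [xy|[-> //|/yx//]]; apply: lt_trans yz. Qed.

Lemma lt_asym x y : x <o y -> ~ y <o x.
Proof. by move=> xy /(lt_trans MG xy)/(lt_irr MG). Qed.

Lemma exists_gt x : exists y, x <o y.
Proof.
exists (gadd x (gone M)); rewrite -{1}(gadd0r MG x).
exact: lt_add2l (lt01 MG).
Qed.

Lemma exists_lt x : exists y, y <o x.
Proof.
exists (gadd x (gopp (gone M))); rewrite -{2}(gadd0r MG x) -(gaddNr MG (gone M)).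
apply: (lt_add2l MG); rewrite -{1}(gadd0l MG (gopp _)).
exact: lt_add2r (lt01 MG).
Qed.

Lemma exists_max x y : exists2 z, z = x \/ z = y & ~ z <o x /\ ~ z <o y.
Proof.
case: (lt_total MG x y) => [xy|[<-|yx]].
- by exists y; [right|split; [apply: lt_asym|apply: lt_irr]].
- by exists x; [left|split; apply: lt_irr].
- by exists x; [left|split; [apply: lt_irr|apply: lt_asym]].
Qed.

Lemma exists_min x y : exists2 z, z = x \/ z = y & ~ x <o z /\ ~ y <o z.
Proof.
case: (lt_total MG x y) => [xy|[<-|yx]].
- by exists x; [left|split; [apply: lt_irr|apply: lt_asym]].
- by exists x; [left|split; apply: lt_irr].
- by exists y; [right|split; [apply: lt_asym|apply: lt_irr]].
Qed.

(** This is the interior in the order topology, and [boundary] below is the topological boundary. *)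
Definition inner X : set M :=
  [set x | exists u v, [/\ u <o x, x <o v & forall t, u <o t -> t <o v -> X t]].

Lemma inner_mono X Y : X `<=` Y -> inner X `<=` inner Y.
Proof. by move=> XY x [u [v [ux xv H]]]; exists u, v; split=> // t ut tv; apply/XY/H. Qed.

Lemma innerI X Y x : inner X x -> inner Y x -> inner (X `&` Y) x.
Proof.
move=> [u [v [ux xv HX]]] [u' [v' [ux' xv' HY]]].
have [w wE [wu wu']] := exists_max u u'; have [s sE [sv sv']] := exists_min v v'.
exists w, s; split; [by case: wE => ->|by case: sE => ->|move=> t wt ts; split].
  by apply: HX; [apply: le_lt_trans wt|apply: lt_le_trans ts _].
by apply: HY; [apply: le_lt_trans wt|apply: lt_le_trans ts _].
Qed.

Lemma inner_interval a b x : open_interval a b x -> inner (open_interval a b) x.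
Proof.
move=> [ax xb].
have [u [ux uP]] : exists u, u <o x /\ forall t, u <o t -> if a is Some c then c <o t else True.
  by case: a ax => [c cx|_]; [exists c|have [u ux] := exists_lt x; exists u].
have [v [xv vP]] : exists v, x <o v /\ forall t, t <o v -> if b is Some c then t <o c else True.
  by case: b xb => [c cx|_]; [exists c|have [v xv] := exists_gt x; exists v].
by exists u, v; split=> // t /uP ? /vP.
Qed.

Definition boundary X : set M := ~` inner X `&` ~` inner (~` X).

Lemma boundaryC X x : boundary X x -> boundary (~` X) x.
Proof. by rewrite /boundary setCK => -[? ?]. Qed.

Lemma boundaryU X Y : boundary (X `|` Y) `<=` boundary X `|` boundary Y.
Proof.
move=> x [iXY oXY]; apply: contrapT => /not_orP[bX bY].
have nX : ~ inner X x by move=> iX; apply: iXY; apply: inner_mono iX; left.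
have nY : ~ inner Y x by move=> iY; apply: iXY; apply: inner_mono iY; right.
apply: oXY; rewrite setCU; apply: innerI; apply: contrapT => N; [exact: bX|exact: bY].
Qed.

(** A point has no boundary but itself, and the boundary of an interval lies among its ends. *)
Lemma boundary_piece X : point_or_interval X -> covered (boundary X).
Proof.
have out_lt x y : x <o y -> inner [set t | t <o y] x.
  by move=> xy; have [u ux] := exists_lt x; exists u, y.
have out_gt x y : x <o y -> inner [set t | x <o t] y.
  by move=> xy; have [v yv] := exists_gt y; exists x, v.
move=> [[p ->]|[a [b ->]]].
  apply: covered_sub (covered1 p) => x [_ oP]; apply: contrapT => xp.
  apply: oP; case: (lt_total MG x p) => [/out_lt|[//|/out_gt]].
    by apply: inner_mono => t /= tp tE; rewrite tE in tp; apply: lt_irr tp.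
  by apply: inner_mono => t /= tp tE; rewrite tE in tp; apply: lt_irr tp.
have cA : covered [set x | Some x = a].
  case: a => [c|]; last by apply: covered_sub (@covered0 _).
  by apply: covered_sub (covered1 c) => x [].
have cB : covered [set x | Some x = b].
  case: b => [c|]; last by apply: covered_sub (@covered0 _).
  by apply: covered_sub (covered1 c) => x [].
apply: covered_sub (covered_union cA cB) => x [iI oI].
apply: contrapT => /not_orP[/= xa xb].
case: (pselect (open_interval a b x)) => [/inner_interval//|/not_andP[] N].
  case: a N xa {iI cA} oI => [c|//] cx xc; apply.
  case: (lt_total MG x c) => [/out_lt|[xE|//]]; last by case: xc; rewrite xE.
  by apply: inner_mono => t /= tc -[/lt_asym].
case: b N xb {iI cB} oI => [c|//] cx xc; apply.
case: (lt_total MG x c) => [//|[xE|/out_gt]]; first by case: xc; rewrite xE.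
by apply: inner_mono => t /= tc -[_ /lt_asym].
Qed.

(** Dedekind completeness for the single set [X], stated as a trichotomy that passes to unions. *)
Definition has_supremum X : Prop :=
  X = set0 \/ (forall t, exists2 x, X x & t <o x) \/
  exists r, (forall x, X x -> ~ r <o x) /\ forall t, t <o r -> exists2 x, X x & t <o x.

Lemma has_supremumU X Y : has_supremum X -> has_supremum Y -> has_supremum (X `|` Y).
Proof.
move=> [->|[HX|[r [rX HX]]]]; first by rewrite set0U.
  by move=> _; right; left => t; have [x Xx tx] := HX t; exists x => //; left.
move=> [->|[HY|[s [sY HY]]]]; first by rewrite setU0; right; right; exists r.
  by right; left => t; have [x Xx tx] := HY t; exists x => //; right.
right; right; have [w wE [wr ws]] := exists_max r s; exists w; split=> [x [/rX|/sY] xr wx|t].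
- by apply: xr; apply: le_lt_trans wx.
- by apply: xr; apply: le_lt_trans wx.
- case: wE => -> => [/HX|/HY][x Zx tx]; exists x => //; [by left|by right].
Qed.

Lemma has_supremum_piece X : point_or_interval X -> has_supremum X.
Proof.
move=> [[p ->]|[a [b ->]]].
  by right; right; exists p; split=> [_ ->|t tp]; [exact: lt_irr|exists p].
case: (pselect (open_interval a b !=set0)) => [[x [ax xb]]|]; last first.
  by move=> N; left; apply/seteqP; split=> // x Ix; case: N; exists x.
case: b xb => [b xb|_].
  right; right; exists b; split=> [y [_ /(lt_asym)] //|t tb].
  have [w wE [wt wx]] := exists_max t x.
  have [|z wz zb] := @lt_dense _ _ MG w b; first by case: wE => ->.
  exists z; last exact: le_lt_trans wz.
  split=> //; case: a ax => // c cx; apply: lt_trans (cx) _ => //; exact: le_lt_trans wz.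
right; left=> t; have [w wE [wt wx]] := exists_max t x; have [z wz] := exists_gt w.
exists z; last exact: le_lt_trans wz.
split=> //; case: a ax => // c cx; apply: lt_trans (cx) _ => //; exact: le_lt_trans wz.
Qed.

End OrderedGroup.

(** O-minimality enters only through this induction over the pieces of a definable set: once for the
    finiteness of boundaries and once for suprema. *)
Lemma ominimal_ind (L : og_language) (M : structure L) (Q : set M -> Prop) :
  ominimal M -> Q set0 -> (forall X, point_or_interval X -> Q X) ->
  (forall X Y, Q X -> Q Y -> Q (X `|` Y)) ->
  forall n (a : 'I_n -> M) X, adef a X -> Q X.
Proof.
move=> OM Q0 Q1 QU n a X [f fX].
have [|k [B [BP ->]]] := OM X.
  by exists n, f, a; split=> //; apply/seteqP; split=> x /fX.
elim: k B BP {fX} => [|k IH] B BP.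
  by rewrite [bigcup _ _](_ : _ = set0) //; apply/seteqP; split=> // x [[]].
rewrite [bigcup _ _](_ : _ = \bigcup_i B (lift ord_max i) `|` B ord_max).
  by apply: QU; [apply: IH|apply: Q1].
apply/seteqP; split=> x.
  move=> [i _]; case: (unliftP ord_max i) => [j|] -> Bx; last by right.
  by left; exists j.
by move=> [[j _ Bx]|Bx]; [exists (lift ord_max j)|exists ord_max].
Qed.

Ltac udef_auto := repeat first [ udef_step | apply: udef_lt ].

(** * Definable completeness and definable connectedness *)

Section Ominimal.
Variables (L : og_language) (M : structure L).
Hypotheses (MG : dense_og M) (OM : ominimal M).
Implicit Types (x y z u v r t : M) (X Y A : set M).

Lemma boundary_covered n (a : 'I_n -> M) X : adef a X -> covered (boundary X).
Proof.
apply: (ominimal_ind (Q := fun Y => covered (boundary Y)) OM) => [|Y|Y Z cY cZ].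
- apply: covered_sub (@covered0 M) => x [_ []].
  by have [u ux] := exists_lt MG x; have [v xv] := exists_gt MG x; exists u, v; split=> // ? _ _ [].
- exact: boundary_piece.
- exact: covered_sub (@boundaryU _ _ MG Y Z) (covered_union cY cZ).
Qed.

Lemma adef_supremum n (a : 'I_n -> M) X : adef a X -> has_supremum X.
Proof.
apply: (ominimal_ind OM) => [|Y|Y Z].
- by left.
- exact: has_supremum_piece.
- exact: has_supremumU.
Qed.

(** The point [r] is the supremum of the set [W] of those [t] for which [X] contains everything from
    [x] to [t]. If [r] were interior to [X], then [W] would reach beyond [r]; if it were interior to
    the complement, points of [W] just below [r], or [x] itself, would lie outside [X]. *)
Lemma boundary_between_lt n (a : 'I_n -> M) X x y : adef a X -> X x -> ~ X y -> x <o y ->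
  exists r, [/\ boundary X r, ~ r <o x & ~ y <o r].
Proof.
move=> [f fX] Xx Xy xy.
pose W := [set t | forall z, ~ z <o x -> ~ t <o z -> X z].
have Wx : W x.
  move=> z zx xz; case: (lt_total MG x z) => [//|[<- //|/zx//]].
have : has_supremum W.
  have [|g gP] := @udef_adef _ n.+1 (fun (N : structure L) (e : 'I_n.+1 -> N) (t : N) =>
      forall z : N, ~ z <o e ord_max -> ~ t <o z ->
        sat f (snoc (fun i => e (lift ord_max i)) z)) M (snoc a x).
    by udef_auto.
  apply: (@adef_supremum _ (snoc a x)); exists g => t; rewrite gP snoc_max snoc_eta.
  by split=> H z zx tz; [apply/fX; apply: H|apply/fX; apply: H].
have Wy t : W t -> t <o y.
  move=> Wt; apply: contrapT => ty; apply: Xy; apply: Wt => //; exact: lt_asym.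
move=> [W0|[/(_ y)[w /Wy wy]|[r [rW Wr]]]]; first by rewrite W0 in Wx.
  by move=> yw; case: (lt_asym MG wy yw).
have rx : ~ r <o x by exact: rW.
have yr : ~ y <o r.
  by move=> /Wr[w /Wy wy yw]; case: (lt_asym MG wy yw).
exists r; split=> //; split=> -[u [v [ur rv uvX]]].
- have [w Ww uw] := Wr u ur; have [v' rv' v'v] := lt_dense MG rv.
  apply: (rW v') => // z zx v'z; case: (pselect (w <o z)) => wz; last exact: Ww.
  by apply: uvX; [apply: lt_trans wz|apply: le_lt_trans v'v].
- case: (pselect (x <o r)) => xr; last first.
    have /uvX[] // : u <o x by apply: lt_le_trans ur xr.
    by apply: le_lt_trans rv.
  have [m mE [mu mx]] := exists_max MG u x.
  have [|w Ww mw] := Wr m; first by case: mE => ->.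
  have wr := rW w Ww.
  apply: (uvX w).
  + exact: le_lt_trans mw.
  + exact: le_lt_trans rv.
  + by apply: Ww; [apply: lt_asym => //; apply: le_lt_trans mw|exact: lt_irr].
Qed.
End Ominimal.

(** * Definable points, intervals with definable ends, and exchange *)

Section Ominimal2.
Variables (L : og_language) (M : structure L).
Hypotheses (MG : dense_og M) (OM : ominimal M).

Lemma adefC n (a : 'I_n -> M) (X : set M) : adef a X -> adef a (~` X).
Proof. by move=> [f fX]; exists (Not f) => y; rewrite sat_Not fX. Qed.

Lemma boundary_between n (a : 'I_n -> M) X x y : adef a X -> X x -> ~ X y ->
  exists2 r, boundary X r & ~ r <o x /\ ~ y <o r \/ ~ r <o y /\ ~ x <o r.
Proof.
move=> aX Xx Xy; case: (lt_total MG x y) => [xy|[xy|yx]].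
- have [r [? ? ?]] := boundary_between_lt MG OM aX Xx Xy xy.
  by exists r => //; left.
- by case: Xy; rewrite -xy.
- have [|r [/boundaryC rX ry xr]] := boundary_between_lt MG OM (adefC aX) Xy _ yx; first by apply.
  by exists r; [rewrite setCK in rX|right].
Qed.

Lemma boundary_between_interval n (a : 'I_n -> M) X b c x y : adef a X ->
  open_interval b c x -> open_interval b c y -> X x -> ~ X y ->
  exists2 r, boundary X r & open_interval b c r.
Proof.
move=> aX [bx xc] [by' yc] Xx Xy.
have [r rX H] := boundary_between aX Xx Xy; exists r => //.
split; [case: b bx by' => // d dx dy|case: c xc yc => // d xd yd].
  by case: H => [[rx _]|[ry _]]; [apply: (lt_le_trans MG dx)|apply: (lt_le_trans MG dy)].
by case: H => [[_ yr]|[_ xr]]; [apply: (le_lt_trans MG yr)|apply: (le_lt_trans MG xr)].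
Qed.

Lemma adef_inner n (a : 'I_n -> M) X : adef a X -> adef a (inner X).
Proof.
move=> [f fX].
have [|g gP] := @udef_adef _ n (fun (N : structure L) (e : 'I_n -> N) x =>
    exists u v, u <o x /\ x <o v /\ forall t, u <o t -> t <o v -> sat f (snoc e t)) M a.
  by udef_auto.
exists g => x; rewrite gP; split=> [[u [v [ux [xv H]]]]|[u [v [ux xv H]]]]; exists u, v.
  by split=> // t ut tv; apply/fX/H.
by do !split=> //; move=> t ut tv; apply/fX/H.
Qed.

Lemma adefI n (a : 'I_n -> M) (X Y : set M) : adef a X -> adef a Y -> adef a (X `&` Y).
Proof. by move=> [f fX] [g gY]; exists (And f g) => y; rewrite sat_And fX gY. Qed.

Lemma adef_boundary n (a : 'I_n -> M) X : adef a X -> adef a (boundary X).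
Proof. by move=> aX; apply: adefI; apply: adefC; apply: adef_inner => //; apply: adefC. Qed.

(** The least element [m] of a finite definable set is definable over the same parameters. The
    elements having another one below them form a definable set without [m], to which the induction
    applies. *)
Lemma covered_adef_dcl n (a : 'I_n -> M) X : adef a X -> covered X -> X `<=` dcl (range a).
Proof.
move=> aX [k [e]]; elim: k e X aX => [|k IH] e X aX Xe x Xx; first by have [[]] := Xe x Xx.
have [|m Xm mP] := @covered_minimal M (@lt_of L M) X (lt_irr MG) (@lt_trans _ _ MG) _ (ex_intro _ x Xx).
  by exists k.+1, e.
have [f fX] := aX.
have mE z : X z /\ (forall y, X y -> ~ y <o z) <-> z = m.
  split=> [[Xz zP]|->] //.
  by have [zm|[//|mz]] := lt_total MG z m; [case: (mP z)|case: (zP m)].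
have [xm|nxm] := pselect (x = m).
  apply: dcl_range; rewrite xm.
  have [|g gP] := @udef_adef _ n (fun (N : structure L) (e : 'I_n -> N) z =>
    sat f (snoc e z) /\ forall y, sat f (snoc e y) -> ~ y <o z) M a; first by udef_auto.
  exists g => z; rewrite gP -[[set m] z]/(z = m) -mE fX.
  by split=> -[Xz zP]; split=> // y /fX; apply: zP.
have [i0 _ i0m] := Xe m Xm.
apply: (IH (fun i => e (lift i0 i)) (X `&` [set z | exists2 y, X y & y <o z])).
- apply: adefI aX _.
  have [|g gP] := @udef_adef _ n (fun (N : structure L) (e : 'I_n -> N) z =>
    exists y, sat f (snoc e y) /\ y <o z) M a; first by udef_auto.
  exists g => z; rewrite gP; split=> [[y [/fX Xy yz]]|[y Xy yz]]; exists y => //.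
  by split=> //; apply/fX.
- move=> z [/[dup] Xz /Xe[i _ iz] [y Xy yz]].
  case: (unliftP i0 i) iz => [j|] -> iz; first by exists j.
  by case: (mP y Xy); rewrite -i0m iz.
- by split=> //; exists m => //; have [//|[mx|/mP//]] := lt_total MG m x; case: nxm.
Qed.

Lemma boundary_dcl n (a : 'I_n -> M) X : adef a X -> boundary X `<=` dcl (range a).
Proof.
move=> aX; apply: covered_adef_dcl; [exact: adef_boundary|exact: (boundary_covered MG OM aX)].
Qed.

Definition in_opt (A : set M) (a : option M) : Prop := if a is Some c then A c else True.

(** The ends are the boundary points of [X] nearest to [x] on either side, or [None] if there are
    none. They belong to the closure of [a] while [x] does not, so [x] is no boundary point itself;
    as no boundary point lies between the ends, connectedness keeps the interval inside [X]. *)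
Lemma interval_around n (a : 'I_n -> M) X x : adef a X -> X x -> ~ dcl (range a) x ->
  exists b c, [/\ in_opt (dcl (range a)) b, in_opt (dcl (range a)) c,
    open_interval b c x & open_interval b c `<=` X].
Proof.
move=> aX Xx nx.
have [b [bB bx bP]] : exists b : option M, [/\ in_opt (boundary X) b,
    (if b is Some d then d <o x else True) &
    forall r, boundary X r -> r <o x -> if b is Some d then ~ d <o r else False].
  case: (pselect ((boundary X `&` [set t | t <o x]) !=set0)) => [N|N]; last first.
    by exists None; split=> // r rX rx; apply: N; exists r.
  have [||b [bX bx] bP] := @covered_minimal M (fun y z => z <o y) _ (lt_irr MG) _ _ N.
  - by move=> u v w vu wv; apply: lt_trans vu.
  - by apply: covered_sub (boundary_covered MG OM aX) => t [].
  - by exists (Some b); split=> // r rX rx; apply: bP.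
have [c [cB xc cP]] : exists c : option M, [/\ in_opt (boundary X) c,
    (if c is Some d then x <o d else True) &
    forall r, boundary X r -> x <o r -> if c is Some d then ~ r <o d else False].
  case: (pselect ((boundary X `&` [set t | x <o t]) !=set0)) => [N|N]; last first.
    by exists None; split=> // r rX rx; apply: N; exists r.
  have [|c [cX xc] cP] := @covered_minimal M (@lt_of L M) _ (lt_irr MG) (@lt_trans _ _ MG) _ N.
  - by apply: covered_sub (boundary_covered MG OM aX) => t [].
  - by exists (Some c); split=> // r rX rx; apply: cP.
exists b, c; split=> //.
- by case: b bB {bx bP} => //= d /(boundary_dcl aX).
- by case: c cB {xc cP} => //= d /(boundary_dcl aX).
move=> y Iy; apply: contrapT => Xy.
have [r rX [br rc]] := boundary_between_interval aX (conj bx xc) Iy Xx Xy.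
have [rx|[rx|xr]] := lt_total MG r x.
- by have := bP r rX rx; case: b br {bB bx bP Iy}.
- by apply: nx; rewrite -rx; apply: (boundary_dcl aX).
- by have := cP r rX xr; case: c rc {cB xc cP Iy}.
Qed.

Lemma dcl_add (A : set M) x y : dcl A x -> dcl A y -> dcl A (gadd x y).
Proof. by move=> Ax Ay; apply: dcl_fun => -[[|[|//]] ?]. Qed.

Lemma dcl_opp (A : set M) x : dcl A x -> dcl A (gopp x).
Proof. by move=> Ax; apply: dcl_fun => i; rewrite [i]ord1 tnth0. Qed.

Lemma dcl_zero (A : set M) : dcl A (gzero M).
Proof. by apply: dcl_fun => -[]. Qed.

Lemma dcl_one (A : set M) : dcl A (gone M).
Proof. by apply: dcl_fun => -[]. Qed.

(** A missing end is obtained by translating the other one by the distinguished element; with both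
    missing, zero and one are used. The point [x] shows that two given ends are in order, and it may
    fall outside the new interval. *)
Lemma interval_shrink (A : set M) (b c : option M) x :
  in_opt (dcl A) b -> in_opt (dcl A) c -> open_interval b c x ->
  exists u v, [/\ dcl A u, dcl A v, u <o v &
    forall t, u <o t -> t <o v -> open_interval b c t].
Proof.
case: b c => [b|] [c|] /= Ab Ac [bx xc].
- by exists b, c; split=> //; apply: lt_trans xc.
- exists b, (gadd b (gone M)); split=> //; first exact: dcl_add Ab (dcl_one _).
  by rewrite -{1}(gadd0r MG b); apply: (lt_add2l MG); apply: lt01.
- exists (gadd (gopp (gone M)) c), c; split=> //.
    by apply: dcl_add => //; apply: dcl_opp; apply: dcl_one.
  rewrite -{2}(gadd0l MG c) -(gaddNl MG (gone M)); apply: (lt_add2r MG).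
  by rewrite -{1}(gadd0r MG (gopp _)); apply: (lt_add2l MG); apply: lt01.
- by exists (gzero M), (gone M); split=> //; [exact: dcl_zero|exact: dcl_one|exact: lt01].
Qed.

Lemma dcl_snoc (A : set M) n (a : 'I_n -> M) x y : (forall i, A (a i)) ->
  dcl (range (snoc a x)) y -> dcl (A `|` [set x]) y.
Proof.
move=> aA; apply: dcl_mono => _ [i _ <-].
by case: (unliftP ord_max i) => [j|] ->; rewrite ?snoc_lift ?snoc_max; [left|right].
Qed.

(* If [b] is the value at [c] of a definable partial function [F] and
   [c] is not in the closure of [A] and [b], then [F] is constant near [c],
   so it is locally constant on an interval around [c] with ends in [dcl A];
   by connectedness its value there is [b], which is thus in [dcl A]. *)
Theorem dcl_exchange (A : set M) b c : dcl (A `|` [set c]) b -> ~ dcl A b -> dcl (A `|` [set b]) c.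
Proof.
move=> Hb nb; apply: contrapT => nc; apply: nb; move: Hb.
rewrite setUC -[[set c]](_ : range (fun _ : 'I_1 => c) = _); last first.
  by apply/seteqP; split=> [_ [_ _ <-]|_ ->] //; exists ord0.
move=> /dcl_unionP[k [q [qA [f fb]]]].
have qdcl : range q `<=` dcl A by move=> _ [i _ <-]; apply: dcl_incl.
pose F (x y : M) := sat f (snoc (cat_env (fun=> x) q) y) /\
  forall z, sat f (snoc (cat_env (fun=> x) q) z) -> z = y.
have Fc : F c b by split=> [|z]; [apply/fb|move/fb].
have F_inj x y z : F x y -> F x z -> y = z by move=> [_ H] [Fz _]; rewrite (H z Fz).
have adefF : adef (snoc q b) [set x | F x b].
  have [|g gP] := @udef_adef _ k.+1 (fun (N : structure L) (e : 'I_k.+1 -> N) x =>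
      sat f (snoc (cat_env (fun=> x) (fun i => e (lift ord_max i))) (e ord_max)) /\
      forall z, sat f (snoc (cat_env (fun=> x) (fun i => e (lift ord_max i))) z) ->
        z = e ord_max) M (snoc q b).
    by udef_auto.
  by exists g => x; rewrite gP snoc_max snoc_eta.
pose Z := [set x | exists y, inner [set t | F t y] x].
have adefZ : adef q Z.
  have [|g gP] := @udef_adef _ k (fun (N : structure L) (e : 'I_k -> N) x =>
      exists y u v, u <o x /\ x <o v /\ forall t, u <o t -> t <o v ->
      sat f (snoc (cat_env (fun=> t) e) y) /\
      forall z, sat f (snoc (cat_env (fun=> t) e) z) -> z = y) M q.
    by udef_auto.
  exists g => x; rewrite gP; split=> [[y [u [v [ux [xv H]]]]]|[y [u [v [ux xv H]]]]].
    by exists y, u, v; split.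
  by exists y, u, v; do !split=> //; apply: H.
have Zc : Z c.
  exists b; have [d [e [_ _ Ic IF]]] := interval_around adefF Fc (fun H => nc (dcl_snoc qA H)).
  exact: inner_mono IF _ (inner_interval MG Ic).
have ncq : ~ dcl (range q) c.
  by move=> H; apply: nc; apply: dcl_mono (dcl_trans qdcl H) => x; left.
have [d [e [dq eq Ic IZ]]] := interval_around adefZ Zc ncq.
have IF y : open_interval d e y -> F y b.
  move=> Iy; apply: contrapT => nF.
  have [r [nr onr] Ir] := boundary_between_interval adefF Ic Iy Fc nF.
  have [y' rF] := IZ _ Ir; case: (pselect (y' = b)) => [yb|yb].
    by apply: nr; rewrite -yb.
  by apply: onr; apply: inner_mono rF => t Ft /F_inj/(_ Ft); apply: contra_not yb => ->.
have [u [v [uq vq uv uvI]]] := interval_shrink dq eq Ic.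
have {uq vq} [uA vA] : dcl A u /\ dcl A v by split; apply: dcl_trans qdcl _ _.
apply: (@dcl_trans _ _ _ (range (snoc (snoc q u) v))).
  move=> _ [i _ <-]; case: (unliftP ord_max i) => [j|] ->; rewrite ?snoc_lift ?snoc_max //.
  case: (unliftP ord_max j) => [l|] ->; rewrite ?snoc_lift ?snoc_max //.
  exact: dcl_incl.
apply: dcl_range.
have [|g gP] := @udef_adef _ k.+2 (fun (N : structure L) (e : 'I_k.+2 -> N) y =>
    exists t, e (lift ord_max ord_max) <o t /\ t <o e ord_max /\
      sat f (snoc (cat_env (fun=> t) (fun i => e (lift ord_max (lift ord_max i)))) y)) M
    (snoc (snoc q u) v).
  by udef_auto.
exists g => y; rewrite gP snoc_lift !snoc_max.
rewrite (_ : (fun i => _) = q); last by apply: funext => i; rewrite !snoc_lift.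
split=> [[t [ut [tv]]]|->].
  by have [_ H] := IF t (uvI t ut tv); apply: H.
have [t ut tv] := lt_dense MG uv; exists t; do !split=> //.
by have [] := IF t (uvI t ut tv).
Qed.

End Ominimal2.

(** * Partial isomorphisms between models of T_e *)

(** This is compactness with the single unknown [tt]: the conditions are those whose solution sets
    belong to [F], and finitely many of them have a common solution because [F] is proper. *)
Lemma realize_filter (K : language) (N : structure K) (F : set_system N) : ProperFilter F ->
  exists (N' : structure K) (j : N -> N') (y : N'), elementary j /\
    forall n (b : 'I_n -> N) (f : form K n.+1), F [set z | sat f (snoc b z)] ->
      sat f (snoc (fun i => j (b i)) y).
Proof.
move=> FF; have FFf : Filter F := @filter_filter _ _ FF.
pose S : set (condition N unit) := [set c | F [set y | meets id (fun=> y) c]].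
have [|N' [j [jel [h hS]]]] := @compactness K N unit S.
  move=> l; suff /filter_ex[y Hy] : F [set y | forall c, List.In c l -> S c -> meets id (fun=> y) c].
    by exists (fun=> y).
  elim: l => [|c l IH]; first by apply: filterS filterT => y _ c [].
  case: (pselect (S c)) => Sc; last by apply: (filterS _ IH) => y H d [<-//|]; apply: H.
  by apply: filterS2 IH Sc => y H Hc d [<-//|]; apply: H.
exists N', j, (h tt); split=> // n b f Ff.
pose c : condition N unit := existT _ n.+1 (f, snoc (fun i => inl (b i)) (inr tt)).
have mE (N1 : structure K) (j1 : N -> N1) h1 :
    meets j1 h1 c <-> sat f (snoc (fun i => j1 (b i)) (h1 tt)).
  rewrite /meets /=; set e := (fun i => _).
  suff -> : e = snoc (fun i => j1 (b i)) (h1 tt) by [].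
  apply: funext => i; rewrite /e.
  by case: (unliftP ord_max i) => [k|] ->; rewrite ?snoc_lift ?snoc_max.
have /hS/mE : S c by apply: filterS Ff => z fz; apply/mE.
by [].
Qed.

Section BackForth.
Variable L : og_language.
Implicit Types M N : structure (lang_e L).

Lemma udef_reduct n (R : forall M : structure L, ('I_n -> M) -> Prop) :
  udef R -> udef (fun M e => R (reduct M) e).
Proof. by move=> [f fR]; exists (embed f) => M e; rewrite sat_embed fR. Qed.

Lemma udef_P n (i : 'I_n) : udef (fun M e => @P_of L M (e i)).
Proof. by exists (fP (Var i)) => M e; rewrite sat_fP. Qed.

Lemma udef_E n (i j : 'I_n) : udef (fun M e => @E_of L M (e i) (e j)).
Proof. by exists (fE (Var i) (Var j)) => M e; rewrite sat_fE. Qed.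

Definition P_free M n (a : 'I_n -> reduct M) : Prop :=
  forall s, P_of s -> (forall i, a i <> s) -> ~ dcl (range a `|` (@P_of L M `\ s)) s.

Lemma elementary_udef (K : language) (M N : structure K) (j : M -> N) n
    (R : forall M : structure K, ('I_n -> M) -> Prop) (a : 'I_n -> M) :
  elementary j -> udef R -> R M a <-> R N (fun i => j (a i)).
Proof. by move=> jel [f fR]; rewrite -!fR; apply: jel. Qed.

(** A failure of freeness in [N] involves one formula [f] and one number [k] of elements of [P]. For
    these the failure is the first-order property [R] of the tuple, which reflects back to [M]. *)
Lemma P_free_elementary M N (j : M -> N) n (a : 'I_n -> M) :
  elementary j -> P_free (M := M) a -> P_free (M := N) (fun i => j (a i)).
Proof.
move=> jel aF s Ps ns /dcl_unionP[k [q [qP [f fs]]]].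
pose R M (a : 'I_n -> M) := exists (q : 'I_k -> M) (s : M),
  ((forall i, @P_of L M (q i)) /\ (forall i, q i <> s)) /\
  (@P_of L M s /\ forall i, a i <> s) /\
  forall y, @sat L (reduct M) _ f (snoc (cat_env a q) y) <-> y = s.
have RU : udef R.
  apply: udef_exn; apply: udef_ex; apply: udef_and; first apply: udef_and.
  - by apply: udef_fin => i; apply: udef_P.
  - by apply: udef_fin => i; udef_auto.
  apply: udef_and; first apply: udef_and.
  - exact: udef_P.
  - by apply: udef_fin => i; udef_auto.
  apply: udef_all; apply: udef_iff; last by udef_auto.
  have := udef_snoc_cat f (fun i => lift ord_max (lift ord_max (lshift k i)))
    (fun i => lift ord_max (lift ord_max (rshift n i))) (@ord_max (n + k).+1).
  exact: udef_reduct.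
have /(elementary_udef a jel RU)[q' [s' [[Pq' q's'] [[Ps' as'] fs']]]] : R N (fun i => j (a i)).
  exists q, s; split; last by [].
  by split=> i; have [] := qP i.
apply: (aF s' Ps' as'); apply/dcl_unionP; exists k, q'; split; last by exists f.
by move=> i; split; [apply: Pq'|apply: q's'].
Qed.

Lemma elementary_P M N (j : M -> N) (x : M) : elementary j -> @P_of L M x <-> @P_of L N (j x).
Proof. by move=> jel; apply: (elementary_udef (fun=> x) jel (@udef_P 1 ord0)). Qed.

Lemma elementary_E M N (j : M -> N) (x y : M) : elementary j ->
  @E_of L M x y <-> @E_of L N (j x) (j y).
Proof.
move=> jel; have := elementary_udef (snoc (fun _ : 'I_1 => x) y) jel (@udef_E 2 ord0 ord_max).
by rewrite !snoc_max (_ : ord0 = lift ord_max (ord0 : 'I_1)) ?snoc_lift //; apply: val_inj.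
Qed.

(* The system of partial isomorphisms of the back-and-forth argument. *)
Record similar M N n (a : 'I_n -> M) (b : 'I_n -> N) : Prop := Similar {
  sim_sat : forall f : form L n, @sat L (reduct M) n f a <-> @sat L (reduct N) n f b;
  sim_P : forall i, @P_of L M (a i) <-> @P_of L N (b i);
  sim_E : forall i j, @E_of L M (a i) (a j) <-> @E_of L N (b i) (b j);
  sim_freel : P_free (M := M) a;
  sim_freer : P_free (M := N) b }.

Lemma similar_sym M N n (a : 'I_n -> M) (b : 'I_n -> N) : similar a b -> similar b a.
Proof. by move=> [H1 H2 H3 H4 H5]; split=> // *; rewrite ?H1 ?H2 ?H3. Qed.

Lemma similar_elementary M N N' (j : N -> N') n (a : 'I_n -> M) (b : 'I_n -> N) :
  elementary j -> similar a b -> similar a (fun i => j (b i)).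
Proof.
move=> jel [H1 H2 H3 H4 H5]; split=> //.
- by move=> f; rewrite H1 -!sat_embed; apply: jel.
- by move=> i; rewrite H2; apply: elementary_P.
- by move=> i k; rewrite H3; apply: elementary_E.
- exact: P_free_elementary.
Qed.

Lemma similar_udef M N n (a : 'I_n -> M) (b : 'I_n -> N)
    (R : forall M : structure L, ('I_n -> M) -> Prop) :
  similar a b -> udef R -> R (reduct M) a <-> R (reduct N) b.
Proof. by move=> ab [f fR]; rewrite -!fR; apply: sim_sat ab f. Qed.

Lemma dcl_rangeP (K : language) (M : structure K) n (a : 'I_n -> M) x :
  dcl (range a) x <-> adef a [set x].
Proof.
split=> [/dclP[m [d [da [f fx]]]]|]; last exact: dcl_range.
have /choice[s sP] : forall i, exists k, a k = d i by move=> i; have [k _] := da i; exists k.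
have [g gP] := @udef_adef _ n (fun (N : structure K) (e : 'I_n -> N) y =>
  sat f (snoc (fun i => e (s i)) y)) M a (udef_snoc f (fun i => lift ord_max (s i)) ord_max).
by exists g => y; rewrite gP (funext sP).
Qed.

Lemma P_free_dcl M n (a : 'I_n -> M) x : P_free (M := M) a -> dcl (M := reduct M) (range a) x ->
  P_of x -> exists i, a i = x.
Proof.
move=> aF ax Px; apply: contrapT => N; apply: (aF x Px).
  by move=> i ai; apply: N; exists i.
by apply: dcl_mono ax => y; left.
Qed.

Lemma range_snoc (A : Type) n (a : 'I_n -> A) x : range (snoc a x) = range a `|` [set x].
Proof.
apply/seteqP; split=> [_ [i _ <-]|y [[i _ <-]|->]].
- by case: (unliftP ord_max i) => [j|] ->; rewrite ?snoc_lift ?snoc_max; [left; exists j|right].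
- by exists (lift ord_max i); rewrite // snoc_lift.
- by exists ord_max; rewrite // snoc_max.
Qed.

Lemma P_free_add_dcl M n (a : 'I_n -> M) x : P_free (M := M) a ->
  dcl (M := reduct M) (range a) x -> P_free (M := M) (snoc a x).
Proof.
move=> aF ax s Ps ns H; apply: (aF s Ps) => [i|].
  by have := ns (lift ord_max i); rewrite snoc_lift.
apply: dcl_trans H => y [|Py]; last by apply: dcl_incl; right.
rewrite range_snoc => -[ay|->]; first by apply: dcl_incl; left.
by apply: dcl_mono ax => z; left.
Qed.

Lemma P_free_add_P M n (a : 'I_n -> M) x : P_free (M := M) a -> @P_of L M x ->
  P_free (M := M) (snoc a x).
Proof.
move=> aF Px s Ps ns H; apply: (aF s Ps) => [i|].
  by have := ns (lift ord_max i); rewrite snoc_lift.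
apply: dcl_mono H => y [|Py]; last by right.
rewrite range_snoc => -[ay|->]; first by left.
by right; split=> // xs; have := ns ord_max; rewrite snoc_max.
Qed.

End BackForth.

(** * Codensity of the closure of [P], and extensions by one point *)

Section Extension.
Variable L : og_language.
Implicit Types M N : structure (lang_e L).

(** If some [s] in [P] came to depend on the others through [x], exchange would put [x] in the
    closure of [a] and [P]. *)
Lemma P_free_add_indep M n (a : 'I_n -> reduct M) x :
  dense_og (reduct M) -> ominimal (reduct M) -> P_free a ->
  ~ dcl (range a `|` @P_of L M) x -> P_free (snoc a x).
Proof.
move=> MG OM aF nx s Ps ns H.
have as' i : a i <> s by have := ns (lift ord_max i); rewrite snoc_lift.
have nds := aF s Ps as'; apply: nx.
have {}H : dcl ((range a `|` (@P_of L M `\ s)) `|` [set x]) s.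
  apply: dcl_mono H => y; rewrite range_snoc => -[[ay|->]|Py]; [by left; left|by right|].
  by left; right.
apply: dcl_mono (dcl_exchange MG OM H nds) => y [[ay|[Py _]]|->]; [by left|by right|by right].
Qed.

(** Whenever a point [c i] falls inside the current interval, it becomes the new upper end. *)
Lemma avoid (M : structure L) n (c : 'I_n -> M) u v : dense_og M -> u <o v ->
  exists u' v', [/\ ~ u' <o u, ~ v <o v', u' <o v' &
    forall t, u' <o t -> t <o v' -> forall i, t <> c i].
Proof.
move=> MG uv; elim: n c => [|n IH] c.
  by exists u, v; split=> //; try exact: lt_irr MG _; move=> t _ _ [].
have [u' [v' [uu' vv' uv' H]]] := IH (fun i => c (lift ord_max i)).
have HS w : u' <o w -> ~ v' <o w -> (forall t, u' <o t -> t <o w -> t <> c ord_max) ->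
    exists u' v', [/\ ~ u' <o u, ~ v <o v', u' <o v' &
    forall t, u' <o t -> t <o v' -> forall i, t <> c i].
  move=> uw v'w Hw; exists u', w; split=> // [vw|t ut tw i].
    by apply: vv'; apply: (lt_le_trans MG vw).
  case: (unliftP ord_max i) => [j|] ->; last exact: Hw.
  by apply: H => //; apply: (lt_le_trans MG tw).
have [uc|nuc] := pselect (u' <o c ord_max /\ c ord_max <o v').
  case: uc => uc cv; apply: (HS (c ord_max)) => //; first exact: (lt_asym MG).
  by move=> t _ tc tE; apply: (lt_irr MG) (c ord_max) _; rewrite -{1}tE.
apply: (HS v') => //; first exact: (lt_irr MG).
by move=> t ut tv tE; apply: nuc; rewrite -tE.
Qed.

Lemma P_avoid M n (c : 'I_n -> reduct M) u v : dense_og (reduct M) ->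
  dense_in setT (@P_of L M) -> u <o v ->
  exists s, [/\ @P_of L M s, u <o s, s <o v & forall i, s <> c i].
Proof.
move=> MG PD uv; have [u' [v' [uu' vv' uv' H]]] := avoid c MG uv.
have [|s [Ps [us sv]]] := PD u' v'.
  by have [t ut tv] := lt_dense MG uv'; exists t.
exists s; split=> //; first exact: (le_lt_trans MG uu').
  exact: (lt_le_trans MG sv).
exact: H.
Qed.

(* The point [y] is the sum of the [p i]. *)
Lemma P_sum M m n (c : 'I_n -> reduct M) u v : dense_og (reduct M) ->
  dense_in setT (@P_of L M) -> u <o v ->
  exists (p : 'I_m.+1 -> reduct M) y, [/\ forall i, @P_of L M (p i),
    injective p, forall i j, p i <> c j, u <o y /\ y <o v &
    dcl (range p) y /\
    forall i, dcl ([set y] `|` [set p j | j in [set j | j <> i]]) (p i)].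
Proof.
move=> MG PD; elim: m n c u v => [|m IH] n c u v uv.
  have [s [Ps us sv sc]] := P_avoid c MG PD uv.
  exists (fun=> s), s; split=> // [i j _|]; first by rewrite [i]ord1 [j]ord1.
  by split=> [|i]; apply: dcl_incl; [exists ord0|left].
have [s [Ps _ _ sc]] := P_avoid c MG PD uv.
(* The other summands are sought in the interval translated by the inverse of [s], and away from [s]
   too, so that all summands are distinct. *)
have uv' : gadd (gopp s) u <o gadd (gopp s) v by exact: lt_add2l.
have [p [y [Pp pI pc [uy yv] [yp pd]]]] := IH _ (snoc c s) _ _ uv'.
have ps i : p i <> s by have := pc i ord_max; rewrite snoc_max.
exists (snoc p s), (gadd s y); split.
- by move=> i; case: (unliftP ord_max i) => [k|] ->; rewrite ?snoc_lift ?snoc_max.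
- move=> i j; case: (unliftP ord_max i) => [k|] ->; case: (unliftP ord_max j) => [l|] ->;
    rewrite ?snoc_lift ?snoc_max // => E; [by rewrite (pI _ _ E)|by case: (ps k)|by case: (ps l)].
- move=> i j; case: (unliftP ord_max i) => [k|] ->; rewrite ?snoc_lift ?snoc_max //.
  by have := pc k (lift ord_max j); rewrite snoc_lift.
- have addK t : gadd s (gadd (gopp s) t) = t by rewrite (gaddA MG) (gaddNr MG) (gadd0l MG).
  by split; [rewrite -(addK u)|rewrite -(addK v)]; apply: lt_add2l.
split=> [|i]; first rewrite range_snoc.
  apply: dcl_add; first by apply: dcl_incl; right.
  by apply: dcl_mono yp => z; left.
case: (unliftP ord_max i) => [k|] ->; rewrite ?snoc_lift ?snoc_max; last first.
  (* The total is [gadd s y]. Cancelling [y] on the right gives back [s]; cancelling [s] on the left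
     gives back [y], and with it the other summands. *)
  rewrite [X in dcl _ X](_ : s = gadd (gadd s y) (gopp y)); last first.
    by rewrite -(gaddA MG) (gaddNr MG) (gadd0r MG).
  apply: dcl_add; first by apply: dcl_incl; left.
  apply: dcl_opp; apply: dcl_mono yp => _ [j _ <-]; right.
  exists (lift ord_max j); last by rewrite snoc_lift.
  by move=> /eqP; rewrite eq_sym (negPf (neq_lift _ _)).
apply: dcl_trans (pd k) => z [->|[j jk <-]].
  rewrite [X in dcl _ X](_ : y = gadd (gopp s) (gadd s y)); last first.
    by rewrite (gaddA MG) (gaddNl MG) (gadd0l MG).
  apply: dcl_add; last by apply: dcl_incl; left.
  apply: dcl_opp; apply: dcl_incl; right; exists ord_max; last by rewrite snoc_max.
  by move=> /eqP; rewrite (negPf (neq_lift _ _)).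
apply: dcl_incl; right; exists (lift ord_max j); last by rewrite snoc_lift.
by move=> /lift_inj.
Qed.

(** By the pigeonhole principle one of the [m.+1] summands, [p i], is not among the at most [m]
    elements [q]. If [y] were definable from [b] and [q], then [p i] would be definable from [b] and
    the rest of [P]. *)
Lemma codense M m n (b : 'I_n -> reduct M) u v : dense_og (reduct M) ->
  dense_in setT (@P_of L M) -> P_free b -> u <o v ->
  exists y, [/\ u <o y, y <o v & forall k (q : 'I_k -> reduct M), (k <= m)%N ->
    (forall i, @P_of L M (q i)) -> ~ dcl (range b `|` range q) y].
Proof.
move=> MG PD bF uv; have [p [y [Pp pI pb [uy yv] [_ pd]]]] := P_sum m b MG PD uv.
exists y; split=> // k q km qP yq.
have [i pq] : exists i, forall j, q j <> p i.
  apply: contrapT => N; have /choice[s sP] : forall i, exists j, q j = p i.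
    move=> i; apply: contrapT => Ni; apply: N; exists i => j ji; apply: Ni.
    by exists j.
  have sI : injective s by move=> i j E; apply: pI; rewrite -!sP E.
  by have := leq_card s sI; rewrite !card_ord leqNgt ltnS km.
apply: (bF (p i)) => // [j bp|]; first by apply: (pb i j).
apply: dcl_trans (pd i) => z [->|[j ji <-]].
  apply: dcl_mono yq => _ [[j _ <-]|[j _ <-]]; first by left; exists j.
  by right; split; [exact: qP|exact: pq].
by apply: dcl_incl; right; split=> [|/pI//]; exact: Pp.
Qed.

(** Reaching [x] may first require finitely many elements of [P], so the tuple may grow by several
    entries; [r] records where the old entries went. The counterparts may lie in an elementary
    extension of [N]. *)
Definition extends M N n (a : 'I_n -> M) (b : 'I_n -> N) (x : M) : Prop :=
  exists (N' : structure (lang_e L)) (j : N -> N') m (a' : 'I_m -> M) (b' : 'I_m -> N')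
    (r : 'I_n -> 'I_m), [/\ elementary j, similar a' b', forall i, a' (r i) = a i,
    forall i, b' (r i) = j (b i) & exists i, a' i = x].

Lemma elementary_id (K : language) (M : structure K) : elementary (id : M -> M).
Proof. by []. Qed.

Lemma elementary_comp (K : language) (M N N' : structure K) (j : M -> N) (j' : N -> N') :
  elementary j -> elementary j' -> elementary (fun x => j' (j x)).
Proof. by move=> H H' n f e; rewrite (H n f e); apply: H'. Qed.

Lemma extends_snoc M N N' (j : N -> N') n (a : 'I_n -> M) (b : 'I_n -> N) x y :
  elementary j -> similar (snoc a x) (snoc (fun i => j (b i)) y) -> extends a b x.
Proof.
move=> jel S; exists N', j, n.+1, (snoc a x), (snoc (fun i => j (b i)) y), (lift ord_max).
by split=> // [i|i|]; [rewrite snoc_lift|rewrite snoc_lift|exists ord_max; rewrite snoc_max].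
Qed.

Lemma extends_trans M N N1 (j : N -> N1) n n1 (a : 'I_n -> M) (b : 'I_n -> N)
    (a1 : 'I_n1 -> M) (b1 : 'I_n1 -> N1) r x : elementary j ->
  (forall i, a1 (r i) = a i) -> (forall i, b1 (r i) = j (b i)) ->
  extends a1 b1 x -> extends a b x.
Proof.
move=> jel ra rb [N2 [j2 [m [a2 [b2 [r2 [jel2 S ra2 rb2 xa]]]]]]].
exists N2, (fun x => j2 (j x)), m, a2, b2, (fun i => r2 (r i)); split=> //.
- exact: elementary_comp.
- by move=> i; rewrite ra2 ra.
- by move=> i; rewrite rb2 rb.
Qed.

Lemma similar_sat_snoc M N n (a : 'I_n -> M) (b : 'I_n -> N) x y :
  (forall f, @sat L (reduct M) n.+1 f (snoc a x) -> @sat L (reduct N) n.+1 f (snoc b y)) ->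
  forall f, @sat L (reduct M) n.+1 f (snoc a x) <-> @sat L (reduct N) n.+1 f (snoc b y).
Proof.
move=> H f; split; first exact: H.
by move=> fb; apply: contrapT => fa; apply: (H (Not f)).
Qed.

(** By freeness, an element of [P] in the closure of [a] is already an entry of [a], and equality
    with that entry is part of the type. *)
Lemma similar_P_old M N n (a : 'I_n -> M) (b : 'I_n -> N) x y : similar a b ->
  (forall f, @sat L (reduct M) n.+1 f (snoc a x) <-> @sat L (reduct N) n.+1 f (snoc b y)) ->
  dcl (M := reduct M) (range a) x ->
  (forall i, @P_of L M (snoc a x i) -> exists k, snoc a x i = a k /\ snoc b y i = b k).
Proof.
move=> S xy ax i; case: (unliftP ord_max i) => [k|] ->; rewrite ?snoc_lift ?snoc_max.
  by exists k.
move=> /(P_free_dcl (sim_freel S) ax)[k ak]; exists k; split=> //.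
have := xy (Eq (Var ord_max) (Var (lift ord_max k))).
by rewrite /= !snoc_max !snoc_lift => <-.
Qed.

(** The formula [f] defining [x] over [a] defines [y] over [b], and any formula [g] about the new
    entry becomes a formula about the old tuple. For [P] and [E] nothing new arises, by
    [similar_P_old]. *)
Lemma similar_add_dcl M N n (a : 'I_n -> M) (b : 'I_n -> N) x :
  (forall x y, @E_of L M x y -> P_of x /\ P_of y) ->
  (forall x y, @E_of L N x y -> P_of x /\ P_of y) -> similar a b ->
  dcl (M := reduct M) (range a) x -> exists y, similar (snoc a x) (snoc b y).
Proof.
move=> EM EN S /[dup] ax /dcl_rangeP[f fx].
pose Rf (N : structure L) (e : 'I_n -> N) := exists y, forall z, sat f (snoc e z) <-> z = y.
have RfU : udef Rf by rewrite /Rf; udef_auto.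
have /(similar_udef S RfU)[y fy] : Rf (reduct M) a by exists x.
have xy : forall g, @sat L (reduct M) n.+1 g (snoc a x) <-> @sat L (reduct N) n.+1 g (snoc b y).
  move=> g; pose Rg (N : structure L) (e : 'I_n -> N) :=
    exists y, sat f (snoc e y) /\ sat g (snoc e y).
  have RgU : udef Rg by rewrite /Rg; udef_auto.
  have := similar_udef S RgU.
  have -> : Rg (reduct M) a <-> @sat L (reduct M) _ g (snoc a x).
    by split=> [[z [/fx -> //]]|gx]; exists x; split=> //; apply/fx.
  have -> // : Rg (reduct N) b <-> @sat L (reduct N) _ g (snoc b y).
  by split=> [[z [/fy -> //]]|gx]; exists y; split=> //; apply/fy.
have bY : dcl (M := reduct N) (range b) y by apply/dcl_rangeP; exists f.
have H1 := similar_P_old S xy ax.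
have H2 := similar_P_old (similar_sym S) (fun f => iff_sym (xy f)) bY.
exists y; split=> //.
- move=> i; split=> [/[dup] Pa /H1[k [ai bi]]|/[dup] Pa /H2[k [bi ai]]].
    by rewrite bi -(sim_P S) -ai.
  by rewrite ai (sim_P S) -bi.
- move=> i j; split=> [/[dup] Eij /EM[/H1[k [ai bi]] /H1[l [aj bj]]]|].
    by rewrite bi bj -(sim_E S) -ai -aj.
  move=> /[dup] Eij /EN[/H2[k [bi ai]] /H2[l [bj aj]]].
  by rewrite ai aj (sim_E S) -bi -bj.
- exact: P_free_add_dcl (sim_freel S) ax.
- exact: P_free_add_dcl (sim_freer S) bY.
Qed.

End Extension.

(** * The back-and-forth argument for models of the theories with a fixed number of classes *)

Section Completeness.
Variables (L : og_language) (T : theory L).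
Hypotheses (T_ominimal : ominimal_theory T)
  (T_dense_og : forall f, dense_og_axiom f -> entails T f).
Implicit Types M N : structure (lang_e L).

Lemma models_T_dense_og (M : structure L) : models M T -> dense_og M.
Proof. by move=> MT; apply: models_dense_og => f /T_dense_og; apply. Qed.

Lemma models_elementary (K : language) (S : theory K) (M N : structure K) (j : M -> N) :
  elementary j -> models M S -> models N S.
Proof.
move=> jel MS f Sf; have := MS f Sf; rewrite /holds (jel _ f).
by rewrite (env0E (fun i => j (@env0 M i))).
Qed.

Lemma similar_snoc M N n (a : 'I_n -> M) (b : 'I_n -> N) x y :
  models M (@T2_axiom L) -> models N (@T2_axiom L) -> similar a b ->
  (forall f, @sat L (reduct M) n.+1 f (snoc a x) -> @sat L (reduct N) n.+1 f (snoc b y)) ->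
  (@P_of L M x <-> @P_of L N y) ->
  (forall i, @E_of L M (a i) x <-> @E_of L N (b i) y) ->
  P_free (M := M) (snoc a x) -> P_free (M := N) (snoc b y) -> similar (snoc a x) (snoc b y).
Proof.
move=> /models_T2[ME1 ME2 ME3 ME4] /models_T2[NE1 NE2 NE3 NE4] S Hf HP HE Fx Fy; split=> //.
- exact: similar_sat_snoc Hf.
- move=> i; case: (unliftP ord_max i) => [k|] ->; rewrite ?snoc_lift ?snoc_max //.
  exact: sim_P.
- move=> i k; case: (unliftP ord_max i) => [l|] ->; case: (unliftP ord_max k) => [m|] ->;
    rewrite ?snoc_lift ?snoc_max //.
  + exact: sim_E.
  + by split=> [/ME3/HE/NE3|/NE3/HE/ME3].
  + by split=> [/ME1[/HP/NE2]|/NE1[/HP/ME2]].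
Qed.

(** In [M] the solutions of [f] around [x] contain an interval, and the existence of such an
    interval is a first-order property of the tuple. *)
Lemma indep_interval M N n (a : 'I_n -> M) (b : 'I_n -> N) x (f : form L n.+1) :
  models (reduct M) T -> similar a b ->
  ~ dcl (M := reduct M) (range a) x -> @sat L (reduct M) _ f (snoc a x) ->
  exists u v : reduct N, u <o v /\ forall t, u <o t -> t <o v -> @sat L (reduct N) _ f (snoc b t).
Proof.
move=> MT S nx fx; have MG := models_T_dense_og MT; have OM := T_ominimal MT.
pose R (M : structure L) (a : 'I_n -> M) := exists u v, u <o v /\
  forall t, u <o t -> t <o v -> sat f (snoc a t).
have RU : udef R by rewrite /R; udef_auto.
apply/(similar_udef S RU).
have aX : adef (M := reduct M) a [set y | @sat L (reduct M) _ f (snoc a y)] by exists f.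
have [d [e [_ _ Ix IX]]] := interval_around MG OM aX fx nx.
have [u [v [ux xv H]]] := inner_interval MG Ix.
exists u, v; split=> [|t ut tv]; first exact: lt_trans xv.
exact: IX (H t ut tv).
Qed.

(** The type of [p] over [a] is to be realized over [b] in the class of [r]. Each of its formulas
    holds on an interval of [N] by [indep_interval]; the interval meets [P] by density, hence also
    the class of [r], so the resulting filter is proper. *)
Lemma similar_add_P M N n (a : 'I_n -> M) (b : 'I_n -> N) p r :
  models M (Te T) -> models N (Te T) -> similar a b ->
  @P_of L M p -> (forall i, a i <> p) -> @P_of L N r ->
  (forall i, @E_of L M (a i) p <-> @E_of L N (b i) r) ->
  exists N' (j : N -> N') q, elementary j /\ similar (snoc a p) (snoc (fun i => j (b i)) q).
Proof.
move=> /models_Te[MT MD MI /models_T2[ME1 ME2 ME3 ME4] MC].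
move=> /models_Te[NT ND NI /models_T2[NE1 NE2 NE3 NE4] NC] S Pp ap Pr apE.
have np : ~ dcl (M := reduct M) (range a) p.
  by move=> /(P_free_dcl (sim_freel S))/(_ Pp)[i /ap].
have NG := models_T_dense_og NT.
pose F : set_system N := filter_from [set f : form L n.+1 | @sat L (reduct M) _ f (snoc a p)]
  (fun f => [set y | @E_of L N r y /\ @sat L (reduct N) _ f (snoc b y)]).
have FF : ProperFilter F.
  apply: filter_from_proper => [|f /(indep_interval MT S np)[u [v [uv H]]]].
    apply: filter_from_filter; first by exists Top; apply/sat_Top.
    move=> f g /= fp gp; exists (And f g); first by apply/sat_And.
    by move=> y [ry /sat_And[fy gy]]; split; split.
  have [t ut tv] := lt_dense NG uv.
  have [|s [Ps Is]] := ND u v; first by exists t.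
  have [|y [ry [uy yv]]] := NC r Pr u v; first by exists s.
  by exists y; split=> //; apply: H.
have [N' [j [q [jel HF]]]] := realize_filter FF.
have rq : @E_of L N' (j r) q.
  have := HF 1%N (fun=> r) (fE (Var (lift ord_max ord0)) (Var ord_max)).
  rewrite sat_fE /= snoc_lift snoc_max; apply.
  by exists Top => [|y /= [ry _]]; [apply/sat_Top|apply/sat_fE; rewrite /= snoc_lift snoc_max].
have satq : forall f, @sat L (reduct M) _ f (snoc a p) ->
    @sat L (reduct N') _ f (snoc (fun i => j (b i)) q).
  move=> f fp; rewrite -sat_embed; apply: HF.
  by exists f => // y [_ fy]; apply/sat_embed.
have TN' : models N' (@T2_axiom L) by apply: models_elementary jel _; apply/models_T2.
have /models_T2[E1 E2 E3 E4] := TN'.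
have Pq : @P_of L N' q by have [] := E1 _ _ rq.
exists N', j, q; split=> //; apply: similar_snoc => //.
- exact/models_T2.
- exact: similar_elementary.
- move=> i; rewrite apE (elementary_E _ _ jel); split=> [/E4/(_ rq) //|bq].
  exact: E4 bq (E3 _ _ rq).
- exact: P_free_add_P (sim_freel S) Pp.
- by apply: P_free_add_P Pq; apply: P_free_elementary (sim_freer S).
Qed.

(** The filter combines the type of [x] over [a] with the conditions [far m], which together keep
    the new point out of the closure of [b] and [P]. An interval on which a formula of the type
    holds contains points of [far m] by [codense]. *)
Lemma similar_add_indep M N n (a : 'I_n -> M) (b : 'I_n -> N) x :
  models M (Te T) -> models N (Te T) -> similar a b ->
  ~ dcl (M := reduct M) (range a `|` @P_of L M) x ->
  exists N' (j : N -> N') y, elementary j /\ similar (snoc a x) (snoc (fun i => j (b i)) y).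
Proof.
move=> /models_Te[MT MD MI MT2 MC] /[dup] NTe /models_Te[NT ND NI NT2 NC] S nx.
have nxa : ~ dcl (M := reduct M) (range a) x.
  by move=> H; apply: nx; apply: dcl_mono H => y; left.
have NG := models_T_dense_og NT.
pose far m := [set y : reduct N | forall k (q : 'I_k -> reduct N), (k <= m)%N ->
   (forall i, @P_of L N (q i)) -> ~ dcl (M := reduct N) (range b `|` range q) y].
pose F : set_system N := filter_from
  [set c : form L n.+1 * nat | @sat L (reduct M) _ c.1 (snoc a x)]
  (fun c => [set y | @sat L (reduct N) _ c.1 (snoc b y) /\ far c.2 y]).
have FF : ProperFilter F.
  apply: filter_from_proper => [|[f m] /= /(indep_interval MT S nxa)[u [v [uv H]]]].
    apply: filter_from_filter; first by exists (Top, 0%N); apply/sat_Top.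
    move=> [f m] [g l] /= fx gx; exists (And f g, maxn m l); first by apply/sat_And.
    move=> y [/sat_And[fy gy] farY]; split; split=> // k q km; apply: farY.
      exact: leq_trans km (leq_maxl _ _).
    exact: leq_trans km (leq_maxr _ _).
  have [y [uy yv yP]] := codense m NG ND (sim_freer S) uv.
  by exists y; split; [exact: H|exact: yP].
have [N' [j [y [jel HF]]]] := realize_filter FF.
have saty : forall f, @sat L (reduct M) _ f (snoc a x) ->
    @sat L (reduct N') _ f (snoc (fun i => j (b i)) y).
  move=> f fx; rewrite -sat_embed; apply: HF.
  by exists (f, 0%N) => // z [fz _]; apply/sat_embed.
have ny : ~ dcl (M := reduct N') (range (fun i => j (b i)) `|` @P_of L N') y.
  move=> /dcl_unionP[k [q [qP [f fy]]]].
  (* Not being defined by [f] from [b] and [k] elements of [P] is a first-order condition on [y],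
     and [far k] implies it. *)
  pose R N (e : 'I_n -> N) (y : N) := ~ exists q : 'I_k -> N, (forall i, @P_of L N (q i)) /\
    forall z, @sat L (reduct N) _ f (snoc (cat_env e q) z) <-> z = y.
  have [g gR] : udef (fun N e => R N (fun i : 'I_n => e (lift ord_max i)) (e ord_max)).
    apply: udef_not; apply: udef_exn; apply: udef_and.
      by apply: udef_fin => i; apply: udef_P.
    apply: udef_all; apply: udef_iff; last by udef_auto.
    have := udef_snoc_cat f (fun i => lift ord_max (lshift k (lift ord_max i)))
      (fun i => lift ord_max (rshift n.+1 i)) (@ord_max (n.+1 + k)).
    exact: udef_reduct.
  have /gR : sat g (snoc (fun i => j (b i)) y).
    apply: HF; exists (Top, k); first by apply/sat_Top.
    move=> z [_ zfar]; apply/gR; rewrite snoc_eta snoc_max => -[q' [Pq' fz]].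
    apply: (zfar k q') => //.
    by apply/dcl_unionP; exists k, q'; split=> [i|]; [exists i|exists f].
  by rewrite snoc_eta snoc_max; apply; exists q.
have TN' : models N' (Te T) by apply: models_elementary jel _.
have /models_Te[NT' _ _ NT2' _] := TN'.
exists N', j, y; split=> //; apply: similar_snoc => //.
- exact: similar_elementary.
- by split=> P; [case: nx|case: ny]; apply: dcl_incl; right.
- have /models_T2[ME1 _ _ _] := MT2; have /models_T2[NE1 _ _ _] := NT2'.
  by move=> i; split=> [/ME1|/NE1] [_ P]; [case: nx|case: ny]; apply: dcl_incl; right.
- apply: P_free_add_indep nx; [exact: models_T_dense_og|exact: T_ominimal|exact: sim_freel S].
- apply: P_free_add_indep ny; [exact: models_T_dense_og|exact: T_ominimal|].
  exact: P_free_elementary (sim_freer S).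
Qed.

Variable p : option nat.

Lemma models_Te_p M : models M (Te_p T p) <-> models M (Te T) /\
  if p is Some n then holds M (exactly_classes L n)
  else forall n, holds M (at_least_classes L n).
Proof.
case: p => [n|]; (split=> [H|[H1 H2] f [/H1 //|]]).
- by split=> [f Tf|]; apply: H; [left|right].
- by move=> ->.
- by split=> [f Tf|n]; apply: H; [left|right; exists n].
- by move=> [n _ <-].
Qed.

(** If the class of [s] contains some [a i], then [b i] serves. Otherwise an [r] in a class missed
    by [b] is needed. If [b] met every class, representatives of distinct classes would inject into
    the indices: with [m] classes, the matching entries of [a] would meet all [m] classes of [M],
    including that of [s]; with infinitely many, [n.+1] representatives would inject into [n]
    indices. *)
Lemma class_choice M N n (a : 'I_n -> M) (b : 'I_n -> N) s :
  models M (Te_p T p) -> models N (Te_p T p) -> similar a b -> @P_of L M s ->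
  exists r, @P_of L N r /\ forall i, @E_of L M (a i) s <-> @E_of L N (b i) r.
Proof.
move=> /models_Te_p[/models_Te[_ _ _ /models_T2[ME1 ME2 ME3 ME4] _] Mp].
move=> /models_Te_p[/models_Te[_ _ _ /models_T2[NE1 NE2 NE3 NE4] _] Np] S Ps.
case: (pselect (exists i, @E_of L M (a i) s)) => [[i0 as0]|ns].
  have [Pa _] := ME1 _ _ as0.
  exists (b i0); split=> [|i]; first by apply/(sim_P S).
  by rewrite -(sim_E S); split=> [H|/ME4/(_ as0)//]; apply: ME4 H (ME3 _ _ as0).
suff [r [Pr br]] : exists r, @P_of L N r /\ forall i, ~ @E_of L N (b i) r.
  by exists r; split=> // i; split=> [ai|/br //]; case: ns; exists i.
apply: contrapT => H.
have bE r : @P_of L N r -> exists i, @E_of L N (b i) r.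
  by move=> Pr; apply: contrapT => Hr; apply: H; exists r; split=> // i Ei; apply: Hr; exists i.
have sel m (e : 'I_m -> N) : (forall i, @P_of L N (e i)) ->
    (forall i j, i != j -> ~ @E_of L N (e i) (e j)) ->
    exists t : 'I_m -> 'I_n, (forall i, @E_of L N (b (t i)) (e i)) /\ injective t.
  move=> eP eE; have /choice[t tP] := fun i => bE (e i) (eP i).
  exists t; split=> // i j tij; apply: contrapT => /eqP/eE; apply.
  by apply: NE4 (NE3 _ _ (tP i)) _; rewrite tij.
case: p Mp Np => [m|].
  move=> /holds_exactly_classes[c [cP cE cS]] /holds_exactly_classes[e [eP eE eS]].
  have [t [tP tI]] := sel m e eP eE.
  have tPa i : @P_of L M (a (t i)) by apply/(sim_P S); have [] := NE1 _ _ (tP i).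
  have /choice[d dP] := fun i => cS _ (tPa i).
  have dI : injective d.
    move=> i j dij; apply: contrapT => /eqP/eE; apply.
    apply: (NE4 _ _ _ (NE3 _ _ (tP i))); apply: (fun h => NE4 _ _ _ h (tP j)).
    rewrite -(sim_E S); apply: (ME4 _ _ _ (ME3 _ _ (dP i))).
    by rewrite dij.
  have [l ls] := cS s Ps.
  have [i il] : exists i, d i = l.
    by exists (invF dI l); apply: f_invF.
  by apply: ns; exists (t i); apply: ME4 (ME3 _ _ (dP i)) _; rewrite il.
move=> _ /(_ n.+1)/holds_at_least_classes[e [eP eE]].
have [t [_ tI]] := sel n.+1 e eP eE.
by have := leq_card t tI; rewrite !card_ord ltnn.
Qed.

(** The induction is on the number of elements of [P] from which [x] is defined: the last one is
    matched by [class_choice] and [similar_add_P], unless it is already an entry of [a]. *)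
Lemma extends_dcl_P M N n k (a : 'I_n -> M) (b : 'I_n -> N) (q : 'I_k -> reduct M) x :
  models M (Te_p T p) -> models N (Te_p T p) -> similar a b ->
  (forall i, @P_of L M (q i)) -> dcl (M := reduct M) (range a `|` range q) x -> extends a b x.
Proof.
move=> MT; elim: k N n a b q => [|k IH] N n a b q NT S qP xq.
  have [/models_Te[_ _ _ /models_T2[ME1 _ _ _] _] _] := (models_Te_p M).1 MT.
  have [/models_Te[_ _ _ /models_T2[NE1 _ _ _] _] _] := (models_Te_p N).1 NT.
  have ax : dcl (M := reduct M) (range a) x by apply: dcl_mono xq => y [//|[[]]].
  have [y Sy] := similar_add_dcl ME1 NE1 S ax.
  exact: extends_snoc (@elementary_id _ N) Sy.
have qE : range q `<=` range (fun i => q (lift ord_max i)) `|` [set q ord_max].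
  move=> _ [i _ <-]; case: (unliftP ord_max i) => [l|] ->; last by right.
  by left; exists l.
have [[i ai]|na] := pselect (exists i, a i = q ord_max).
  apply: (IH N n a b (fun i => q (lift ord_max i))) => //.
  apply: dcl_mono xq => y [ay|/qE[qy|->]]; [by left|by right|].
  by left; exists i.
have [r [Pr rE]] := class_choice MT NT S (qP ord_max).
have [MTe _] := (models_Te_p M).1 MT; have [NTe _] := (models_Te_p N).1 NT.
have [|N' [j [s [jel S']]]] := similar_add_P MTe NTe S (qP ord_max) _ Pr rE.
  by move=> i ai; apply: na; exists i.
have NT' := models_elementary jel NT.
apply: (extends_trans (r := lift ord_max) jel); last first.
- apply: (IH N' n.+1 _ _ (fun i => q (lift ord_max i)) NT' S') => //.
  apply: dcl_mono xq => y; rewrite range_snoc.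
  by move=> [ay|/qE[qy|->]]; [left; left|right|left; right].
- by move=> i; rewrite snoc_lift.
- by move=> i; rewrite snoc_lift.
Qed.

Lemma similar_extends M N n (a : 'I_n -> M) (b : 'I_n -> N) x :
  models M (Te_p T p) -> models N (Te_p T p) -> similar a b -> extends a b x.
Proof.
move=> MT NT S.
have [MTe _] := (models_Te_p M).1 MT; have [NTe _] := (models_Te_p N).1 NT.
have [|nx] := pselect (dcl (M := reduct M) (range a `|` @P_of L M) x).
  move=> /dcl_unionP[k [q [qP fx]]]; apply: (extends_dcl_P MT NT S qP).
  by apply/dcl_unionP; exists k, q; split=> // i; exists i.
have [N' [j [y [jel Sy]]]] := similar_add_indep MTe NTe S nx.
exact: extends_snoc jel Sy.
Qed.

Lemma term_reduct n (t : term (lang_e L) n) : exists t' : term L n,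
  forall M (e : 'I_n -> M), @eval L (reduct M) n e t' = eval e t.
Proof.
elim: t => [i|k c ts /choice[ts' H]]; first by exists (Var i).
by exists (App (c : func_sym L k) ts') => M e /=; congr (fun_of M); apply: funext => i; apply: H.
Qed.

(** With values of terms as new entries, atomic formulas in [P] and [E] reduce to [sim_P] and
    [sim_E]. *)
Lemma similar_term M N n (a : 'I_n -> M) (b : 'I_n -> N) (t : term L n) :
  models M (Te_p T p) -> models N (Te_p T p) -> similar a b ->
  similar (snoc a (@eval L (reduct M) n a t)) (snoc b (@eval L (reduct N) n b t)).
Proof.
move=> MT NT S.
have [/models_Te[_ _ _ /models_T2[ME1 _ _ _] _] _] := (models_Te_p M).1 MT.
have [/models_Te[_ _ _ /models_T2[NE1 _ _ _] _] _] := (models_Te_p N).1 NT.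
pose f := Eq (Var ord_max) (rename_term (lift ord_max) t).
have fE (M1 : structure L) (e : 'I_n -> M1) y : sat f (snoc e y) <-> y = eval e t.
  by rewrite /= eval_rename snoc_max (_ : _ \o _ = e) //; apply: funext => i /=; rewrite snoc_lift.
have ax : dcl (M := reduct M) (range a) (@eval L (reduct M) n a t).
  by apply: dcl_range; exists f => y; rewrite fE.
have [y Sy] := similar_add_dcl ME1 NE1 S ax.
suff <- : y = @eval L (reduct N) n b t by [].
by apply/(fE (reduct N) b y)/(sim_sat Sy)/(fE (reduct M) a).
Qed.

(** The renaming [s] is there because [extends] may add entries besides the witness, at any
    position. In the quantifier case one direction suffices by symmetry; the counterpart of [x] lies
    in an elementary extension of [N], where the universal formula still holds. *)
Lemma similar_sat m (f : form (lang_e L) m) : forall n (s : 'I_m -> 'I_n) M N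
    (a : 'I_n -> M) (b : 'I_n -> N),
  models M (Te_p T p) -> models N (Te_p T p) -> similar a b ->
  sat f (fun i => a (s i)) <-> sat f (fun i => b (s i)).
Proof.
elim: f => [{}m|{}m t u|{}m k r ts|{}m f IHf g IHg|{}m f IHf] n s M N a b MT NT S.
- by [].
- have [t' tE] := term_reduct t; have [u' uE] := term_reduct u.
  rewrite /= -!tE -!uE; have := sim_sat S (rename (Eq t' u') s).
  by rewrite !sat_rename.
- have /choice[ts' tsE] := fun i => term_reduct (ts i).
  have evE M1 (e : 'I_n -> M1) i : eval (fun i => e (s i)) (ts i) =
      @eval L (reduct M1) n e (rename_term s (ts' i)).
    by rewrite eval_rename -tsE.
  rewrite /= (funext (evE M a)) (funext (evE N b)).
  case: r ts ts' tsE evE => [{}k r|/=|/=] ts ts' tsE evE.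
  + exact: (sim_sat S (Rel r (fun i => rename_term s (ts' i)))).
  + have := sim_P (similar_term (rename_term s (ts' ord0)) MT NT S) ord_max.
    rewrite !snoc_max /P_of /=.
    set e1 := tnth _; set e2 := tnth _.
    have -> : e1 = (fun i => @eval L (reduct M) n a (rename_term s (ts' i))).
      by apply: funext => i; rewrite /e1 [i]ord1 tnth0.
    have -> // : e2 = (fun i => @eval L (reduct N) n b (rename_term s (ts' i))).
    by apply: funext => i; rewrite /e2 [i]ord1 tnth0.
  + have S1 := similar_term (rename_term s (ts' ord0)) MT NT S.
    have := sim_E (similar_term (rename_term (lift ord_max) (rename_term s (ts' ord_max))) MT NT S1)
       (lift ord_max ord_max) ord_max.
    rewrite !snoc_lift !snoc_max !(eval_rename (lift ord_max)) /E_of.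
    have liftE (M1 : structure L) (e : 'I_n -> M1) x : snoc e x \o lift ord_max = e.
      by apply: funext => i /=; rewrite snoc_lift.
    rewrite !liftE.
    set e1 := tnth _; set e2 := tnth _.
    have two (i : 'I_2) : i = ord0 \/ i = ord_max.
      by case: i => -[|[|//]] ?; [left|right]; apply: val_inj.
    have -> : e1 = (fun i => @eval L (reduct M) n a (rename_term s (ts' i))).
      by apply: funext => i; rewrite /e1; have [->|->] := two i.
    have -> // : e2 = (fun i => @eval L (reduct N) n b (rename_term s (ts' i))).
    by apply: funext => i; rewrite /e2; have [->|->] := two i.
- by rewrite /= (IHf n s M N a b) // (IHg n s M N a b).
- suff H : forall M N (a : 'I_n -> M) (b : 'I_n -> N),
      models M (Te_p T p) -> models N (Te_p T p) -> similar a b ->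
      sat (All f) (fun i => b (s i)) -> sat (All f) (fun i => a (s i)).
    by split; [apply: H (similar_sym S)|apply: H S].
  move=> {}M {}N {}a {}b {}MT {}NT {}S fb x.
  have [N' [j [m' [a' [b' [r [jel S' ra rb [i ix]]]]]]]] := similar_extends x MT NT S.
  have NT' := models_elementary jel NT.
  have sE M1 (e : 'I_m' -> M1) : (fun k => e (snoc (fun l => r (s l)) i k)) =
    snoc (fun l => e (r (s l))) (e i) by rewrite (map_snoc e).
  have := IHf m' (snoc (fun l => r (s l)) i) M N' a' b' MT NT' S'.
  rewrite !sE ix (_ : (fun l => a' _) = fun l => a (s l)); last by apply: funext => l; rewrite ra.
  rewrite (_ : (fun l => b' _) = fun l => j (b (s l))); last by apply: funext => l; rewrite rb.
  by move=> [_ H]; apply: H; have /jel /= := fb; apply.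
Qed.

End Completeness.

(** The empty tuples of two models are similar, since [T] is complete and [P] is independent. So all
    models agree on [f]. *)
Theorem Te_p_decides (L : og_language) (T : theory L) (p : option nat) :
  complete T -> ominimal_theory T -> (forall f, dense_og_axiom f -> entails T f) ->
  forall f, entails (Te_p T p) f \/ entails (Te_p T p) (Not f).
Proof.
move=> [_ T_dec] OM OG f.
have key (M N : structure (lang_e L)) : models M (Te_p T p) -> models N (Te_p T p) ->
    holds M f <-> holds N f.
  move=> MT NT; have S : similar (@env0 M) (@env0 N).
    have [/models_Te[MT' _ MI _ _] _] := (models_Te_p T p M).1 MT.
    have [/models_Te[NT' _ NI _ _] _] := (models_Te_p T p N).1 NT.
    have env0_free (M1 : structure (lang_e L)) : @dcl_independent L (reduct M1) (@P_of L M1) ->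
        P_free (M := M1) (@env0 M1).
      by move=> I s Ps _ H; apply: (I s Ps); apply: dcl_mono H => y [[[]]|].
    split=> [g|[]|[]||] //; try exact: env0_free.
    have [Tg|Tg] := T_dec g; first by split=> _; [have := Tg _ NT'|have := Tg _ MT'].
    by split=> H; [have := Tg _ MT'|have := Tg _ NT']; case.
  have := similar_sat OM OG f id MT NT S.
  by rewrite /holds (env0E (fun i => @env0 M i)) (env0E (fun i => @env0 N i)).
have [[M [MT Mf]]|N] := pselect (exists M, models M (Te_p T p) /\ holds M f).
  by left=> N NT; apply/(key M N).
by right=> M MT Mf; apply: N; exists M.
Qed.

(** * Existence of models *)

(** Names are compared by rank first, and within one rank by a well-order given by the axiom of
    choice. *)
Lemma well_order_refining (V : Type) (rk : V -> nat) : exists lt : V -> V -> Prop,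
  [/\ forall x, ~ lt x x, forall x y z, lt x y -> lt y z -> lt x z,
      forall x y, lt x y \/ x = y \/ lt y x, well_founded lt &
      forall x y, (rk x < rk y)%N -> lt x y].
Proof.
have [R wR] := wochoice.well_ordering_principle {classic V}.
have Ranti x y : R x y -> R y x -> x = y.
  move=> xy yx; apply: (@wochoice.wo_chain_antisymmetric _ R predT) => //.
    by move=> A _; apply: wR.
  by rewrite xy yx.
pose lt (x y : V) := (rk x < rk y)%N \/ [/\ rk x = rk y, x <> y & R x y].
have lt_irr x : ~ lt x x by move=> [|[_ //]]; rewrite ltnn.
have lt_asym x y : lt x y -> ~ lt y x.
  move=> [xy|[xy nxy Rxy]] [yx|[yx nyx Ryx]].
  - by have := ltn_trans xy yx; rewrite ltnn.
  - by rewrite yx ltnn in xy.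
  - by rewrite xy ltnn in yx.
  - exact: nxy (Ranti _ _ Rxy Ryx).
(* The remaining properties follow from asymmetry, irreflexivity and least elements; transitivity
   and totality use the least element of a set of three or two names. *)
have least (A : set V) : A !=set0 -> exists2 m, A m & forall z, A z -> z = m \/ lt m z.
  move=> [x0 Ax0].
  have ex : exists n, `[<exists2 x, A x & rk x = n>] by exists (rk x0); apply/asboolP; exists x0.
  case: (ex_minnP ex) => n /asboolP[x1 Ax1 rx1] nmin.
  have [|m [[+ mmin] _]] := wR [pred x : {classic V} | `[<A x>] && (rk x == n)].
    by exists x1; rewrite inE /= rx1 eqxx andbT; apply/asboolP.
  rewrite inE /= => /andP[/asboolP Am /eqP rm]; exists m => // z Az.
  have : (n <= rk z)%N by apply: nmin; apply/asboolP; exists z.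
  rewrite leq_eqVlt => /orP[/eqP nz|nz]; last by right; left; rewrite rm.
  have [->|zm] := pselect (z = m); [by left|right; right; split].
  - by rewrite rm.
  - by move=> mz; apply: zm.
  - by apply: mmin; rewrite inE /= -nz eqxx andbT; apply/asboolP.
exists lt; split.
- exact: lt_irr.
- move=> x y z xy yz.
  have [|m [->|[->|->]] mP] := least [set t | t = x \/ t = y \/ t = z]; first by exists x; left.
  + have [zx|//] := mP z (or_intror (or_intror erefl)).
    by rewrite zx in yz; case: (lt_asym _ _ xy yz).
  + have [xE|/(lt_asym _ _ xy)//] := mP x (or_introl erefl).
    by rewrite xE in xy; case: (lt_irr _ xy).
  + have [yE|/(lt_asym _ _ yz)//] := mP y (or_intror (or_introl erefl)).
    by rewrite yE in yz; case: (lt_irr _ yz).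
- move=> x y.
  have [|m [->|->] mP] := least [set t | t = x \/ t = y]; first by exists x; left.
    by have [->|?] := mP y (or_intror erefl); [right; left|left].
  by have [->|?] := mP x (or_introl erefl); right; [left|right].
- move=> x; apply: contrapT => nx.
  have [m nm mP] := least [set x | ~ Acc lt x] (ex_intro _ x nx).
  apply: nm; constructor => y ym; apply: contrapT => ny.
  by have [yE|/(lt_asym _ _ ym)//] := mP y ny; rewrite yE in ym; case: (lt_irr _ ym).
- by move=> x y; left.
Qed.

(* Names for the elements of [P] of the model under construction: [Name f g args c]
   is an element of the class [c] in the interval whose ends are defined by [f] and
   [g] over the elements named by [args]. *)
Inductive name (L : language) (C : Type) : Type :=
| Name n of form L n.+1 & form L n.+1 & ('I_n -> name L C) & C.

Fixpoint name_rank (L : language) (C : Type) (v : name L C) : nat :=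
  let: Name n _ _ args _ := v in (\max_(i < n) name_rank (args i)).+1.

Definition color (L : language) (C : Type) (v : name L C) : C :=
  let: Name _ _ _ _ c := v in c.

Definition defines (L : language) (M : structure L) n (f : form L n.+1) (e : 'I_n -> M) (x : M) :=
  forall y, sat f (snoc e y) <-> y = x.

Lemma defines_inj (L : language) (M : structure L) n (f : form L n.+1) (e : 'I_n -> M) x x' :
  defines f e x -> defines f e x' -> x = x'.
Proof. by move=> H H'; apply/H'; apply/H. Qed.

(** * Simultaneous choice of generic values for all names *)

Section Names.
Variables (L : og_language) (C : Type).
Local Notation V := (name L C).
Variable lt : V -> V -> Prop.
Hypotheses (ltv_irr : forall v, ~ lt v v)
  (ltv_trans : forall v w u, lt v w -> lt w u -> lt v u)
  (ltv_total : forall v w, lt v w \/ v = w \/ lt w v)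
  (ltv_wf : well_founded lt)
  (ltv_rank : forall v w, (name_rank v < name_rank w)%N -> lt v w).

Lemma ltv_args n (f g : form L n.+1) (args : 'I_n -> V) c i : lt (args i) (Name f g args c).
Proof. by apply: ltv_rank; rewrite /= ltnS; apply: (leq_bigmax (F := fun i => name_rank (args i))). Qed.

(** One dependence is one instance of the demand that the value of a name avoid the definable
    closure of the values of smaller names. *)
Record dependence := Dependence {
  dep_n : nat; dep_f : form L dep_n.+1; dep_args : 'I_dep_n -> V; dep_target : V;
  dep_lt : forall i, lt (dep_args i) dep_target }.

Arguments dep_args : clear implicits.

(** The demand is vacuous unless the two formulas define the ends of a nonempty interval, so that it
    can be met for every name. *)
Definition in_place (M : structure L) (h : V -> M) (v : V) (x : M) : Prop :=
  let: Name n f g args c := v in forall u w,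
    defines f (fun i => h (args i)) u -> defines g (fun i => h (args i)) w ->
    u <o w -> u <o x /\ x <o w.

Definition avoids (M : structure L) (h : V -> M) (d : dependence) (x : M) : Prop :=
  ~ defines (dep_f d) (fun i => h (dep_args d i)) x.

(** Each dependence in the list forbids at most one point, and a nonempty interval has points
    outside any finite set. *)
Lemma choose_value (M : structure L) (h : V -> M) (l : seq dependence) v : dense_og M ->
  exists x, in_place h v x /\ forall d, List.In d l -> dep_target d = v -> avoids h d x.
Proof.
move=> MG.
have cov : covered [set x | exists d, List.In d l /\ ~ avoids h d x].
  elim: l => [|d l IH]; first by apply: covered_sub (@covered0 M) => x [d [[]]].
  have covd : covered [set x | ~ avoids h d x].
    have [[x0 Hx0]|nx] := pselect (exists x, ~ avoids h d x); last first.
      by apply: covered_sub (@covered0 M) => x Hx; apply: nx; exists x.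
    apply: covered_sub (covered1 x0) => x /= /contrapT Hx.
    exact: defines_inj Hx (contrapT Hx0).
  apply: covered_sub (covered_union IH covd) => x [d' [[<-|dl] Hd]]; first by right.
  by left; exists d'.
have [k [e eP]] := cov.
have key u w : u <o w -> exists x, [/\ u <o x, x <o w & forall d, List.In d l -> avoids h d x].
  move=> uw; have [u' [w' [uu' ww' uw' H]]] := avoid e MG uw.
  have [x ux xw] := lt_dense MG uw'; exists x; split.
  - exact: (le_lt_trans MG uu').
  - exact: (lt_le_trans MG xw).
  - move=> d dl; apply: contrapT => nd; have [i _ ix] := eP x (ex_intro _ d (conj dl nd)).
    exact: H x ux xw i (esym ix).
case: v => n f g args c /=.
have [[u [w [fu gw uw]]]|N] := pselect (exists u w,
  [/\ defines f (fun i => h (args i)) u, defines g (fun i => h (args i)) w & u <o w]).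
  have [x [ux xw xP]] := key _ _ uw; exists x; split=> [u' w' fu' gw' _|d dl _]; last exact: xP.
  by rewrite (defines_inj fu' fu) (defines_inj gw' gw).
(* With no interval to respect, the point is taken between zero and one. *)
have [x [_ _ xP]] := key _ _ (lt01 MG); exists x; split=> [u w fu gw uw|d dl _]; last exact: xP.
by case: N; exists u, w.
Qed.

(** The recursion runs along [lt]. The demands on [v] read [h] only at smaller names, so the values
    found so far are extended by zero in [ext]. *)
Lemma choose_values (M : structure L) (l : seq dependence) : dense_og M ->
  exists h : V -> M, (forall v, in_place h v (h v)) /\
    forall d, List.In d l -> avoids h d (h (dep_target d)).
Proof.
move=> MG; have /choice[pick pickP] : forall hv : (V -> M) * V, exists x, in_place hv.1 hv.2 x /\
    forall d, List.In d l -> dep_target d = hv.2 -> avoids hv.1 d x.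
  by move=> [h v]; apply: choose_value.
pose ext v (rec : forall w, lt w v -> M) w :=
  if pselect (lt w v) is left wv then rec w wv else gzero M.
pose h := Fix ltv_wf (fun=> M) (fun v rec => pick (ext v rec, v)).
have hE v : h v = pick (ext v (fun w _ => h w), v).
  rewrite /h Fix_eq // => w r r' rr'; congr (pick (ext w _, w)).
  by apply: functional_extensionality_dep => u; apply: functional_extensionality_dep => uw.
have extE v w : lt w v -> ext v (fun w _ => h w) w = h w by rewrite /ext; case: pselect.
have argsE v n (args : 'I_n -> V) : (forall i, lt (args i) v) ->
    (fun i => ext v (fun w _ => h w) (args i)) = fun i => h (args i).
  by move=> H; apply: funext => i; rewrite extE.
exists h; split=> [v|d dl].
  have [+ _] := pickP (ext v (fun w _ => h w), v); rewrite -hE /=.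
  by case: v => n f g args c /=; rewrite (argsE (Name f g args c)) // => i; apply: ltv_args.
have [_ /(_ d dl erefl)] := pickP (ext (dep_target d) (fun w _ => h w), dep_target d).
by rewrite -hE /avoids argsE //; apply: dep_lt.
Qed.

Lemma condition_named (M : structure L) n (R : forall N : structure L, ('I_n -> N) -> N -> Prop)
    (args : 'I_n -> V) v :
  udef (n := n.+1) (fun N e => R N (fun i => e (lift ord_max i)) (e ord_max)) ->
  exists c : condition M V, forall (N : structure L) (j : M -> N) h,
    meets j h c <-> R N (fun i => h (args i)) (h v).
Proof.
move=> [f fR]; exists (existT _ n.+1 (f, snoc (fun i => inr (args i)) (inr v))) => N j h.
rewrite /meets /= fR snoc_max.
by rewrite (_ : (fun i => _) = fun i => h (args i)) //; apply: funext => i; rewrite snoc_lift.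
Qed.

(** This is compactness with the names as unknowns: [choose_values] puts all names in place at once
    while respecting any finite list of dependences. *)
Lemma generic_values (M : structure L) : dense_og M ->
  exists (N : structure L) (j : M -> N), elementary j /\ exists h : V -> N,
    (forall v, in_place h v (h v)) /\ forall d, avoids h d (h (dep_target d)).
Proof.
move=> MG.
have /choice[cv cvP] : forall v : V, exists c : condition M V, forall (N : structure L) (j : M -> N) h,
    meets j h c <-> in_place h v (h v).
  case=> n f g args c.
  apply: (condition_named M (R := fun N e x => forall u w, defines f e u -> defines g e w ->
     u <o w -> u <o x /\ x <o w) args (Name f g args c)).
  by rewrite /defines; udef_auto.
have /choice[cd cdP] : forall d, exists c : condition M V, forall (N : structure L) (j : M -> N) h,
    meets j h c <-> avoids h d (h (dep_target d)).
  move=> d; apply: (condition_named M (R := fun N e x => ~ defines (dep_f d) e x)).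
  by rewrite /defines; udef_auto.
pose S := [set c | (exists v, c = cv v) \/ exists d, c = cd d].
have [|N [j [jel [h hS]]]] := @compactness _ M V S; last first.
  exists N, j; split=> //; exists h; split=> [v|d].
    by apply/cvP; apply: hS; left; exists v.
  by apply/cdP; apply: hS; right; exists d.
(* A condition need not determine its dependence, so [l'] collects one dependence for each condition
   of [l] that comes from some. *)
move=> l; have [l' l'P] : exists l' : seq dependence, forall c d, List.In c l -> c = cd d ->
    exists2 d', List.In d' l' & c = cd d'.
  elim: l => [|c l [l' IH]]; first by exists [::].
  have [[d cE]|N] := pselect (exists d, c = cd d).
    exists (d :: l') => c' d' [<- _|cl cE']; first by exists d => //; left.
    by have [d2 d2l c2] := IH c' d' cl cE'; exists d2 => //; right.
  by exists l' => c' d' [<- cE|cl cE']; [case: N; exists d'|apply: IH cE'].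
have [h [h1 h2]] := choose_values l' MG; exists h => c cl [[v ->]|[d cE]].
  exact/cvP.
by have [d' dl ->] := l'P c d cl cE; apply/cdP; apply: h2.
Qed.

End Names.

(** * The model generated by the values of the names *)

Section GenericModel.
Variables (L : og_language) (T : theory L) (C : Type) (c0 : C).
Hypotheses (T_ominimal : ominimal_theory T)
  (T_dense_og : forall f, dense_og_axiom f -> entails T f).
Local Notation V := (name L C).
Variables (lt : V -> V -> Prop).
Hypotheses (ltv_irr : forall v, ~ lt v v)
  (ltv_trans : forall v w u, lt v w -> lt w u -> lt v u)
  (ltv_total : forall v w, lt v w \/ v = w \/ lt w v).
Variables (N : structure L) (h : V -> N).
Hypotheses (NT : models N T) (h_place : forall v, in_place h v (h v))
  (h_avoids : forall d : dependence lt, avoids h d (h (dep_target d))).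

Let NG : dense_og N := models_T_dense_og T_dense_og NT.
Let NO : ominimal N := T_ominimal NT.

Lemma value_avoids n (args : 'I_n -> V) v : (forall i, lt (args i) v) ->
  ~ dcl (range (fun i => h (args i))) (h v).
Proof. by move=> H /dcl_rangeP[f fv]; apply: (@h_avoids (Dependence f H)). Qed.

(* The greatest of the names involved can be put last by the exchange property. *)
Lemma value_indep n (args : 'I_n -> V) v : (forall i, args i <> v) ->
  ~ dcl (range (fun i => h (args i))) (h v).
Proof.
elim: n args v => [|n IH] args v av; first by apply: value_avoids => -[].
have cov : covered (range args `|` [set v]).
  apply: covered_union (@covered1 _ v); by exists n.+1, args.
have [|m mE mP] := covered_minimal (R := fun x y => lt y x) ltv_irr _ cov (ex_intro _ v (or_intror erefl)).
  by move=> x y z yx zy; apply: ltv_trans yx.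
have le_m w : (range args `|` [set v]) w -> w <> m -> lt w m.
  by move=> /mP wm nwm; have [//|[//|/wm//]] := ltv_total w m.
case: mE => [[i0 _ mE]|mE]; last first.
  apply: value_avoids => i; have := @le_m (args i); rewrite mE; apply; last exact: av.
  by left; exists i.
set args' := fun i => args (lift i0 i).
have IHv : ~ dcl (range (fun i => h (args' i))) (h v) by apply: IH => i; apply: av.
have rE : range (fun i => h (args i)) `<=` range (fun i => h (args' i)) `|` [set h m].
  move=> _ [i _ <-]; case: (unliftP i0 i) => [j|] ->; last by right; rewrite -mE.
  by left; exists j.
(* If [m] occurs again among the other arguments, dropping the argument at [i0] loses nothing. *)
have [[i1 i1m]|nm] := pselect (exists i, args' i = m).
  move=> H; apply: IHv; apply: dcl_mono H => y /rE[//|->].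
  by exists i1; rewrite // i1m.
move=> /(dcl_mono rE)/(dcl_exchange NG NO)/(_ IHv) H.
apply: (@value_avoids _ (snoc args' v) m).
  move=> i; case: (unliftP ord_max i) => [j|] ->; rewrite ?snoc_lift ?snoc_max; apply: le_m.
  - by left; exists (lift i0 j).
  - by move=> jm; apply: nm; exists j.
  - by right.
  - by move=> vm; apply: (av i0); rewrite mE vm.
by rewrite (map_snoc h) range_snoc.
Qed.

Lemma value_inj : injective h.
Proof.
move=> v w hvw; apply: contrapT => vw.
apply: (@value_indep 1 (fun=> w) v) => [_ wv|]; first by apply: vw.
by rewrite hvw; apply: dcl_incl; exists ord0.
Qed.

Let P0 : set N := range h.

(** The definitions of [u] and [w] over named points, renamed to the concatenated arguments, make up
    a name for a point between them. *)
Lemma value_between u w c : dcl P0 u -> dcl P0 w -> u <o w ->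
  exists v, [/\ color v = c, u <o h v & h v <o w].
Proof.
move=> /dclP[n [a [aP [f fu]]]] /dclP[m [b [bP [g gw]]]] uw.
have /choice[s sE] : forall i, exists v, h v = a i by move=> i; have [v _] := aP i; exists v.
have /choice[t tE] : forall i, exists v, h v = b i by move=> i; have [v _] := bP i; exists v.
pose v := Name (rename f (rename_up (lshift m))) (rename g (rename_up (@rshift n m))) (cat_env s t) c.
have [||//|uv vw] := h_place v u w; last by exists v.
- by move=> y; rewrite sat_rename snoc_rename_up map_cat (_ : _ \o _ = a) //;
    apply: funext => i /=; rewrite cat_lshift sE.
- by move=> y; rewrite sat_rename snoc_rename_up map_cat (_ : _ \o _ = b) //;
    apply: funext => i /=; rewrite cat_rshift tE.
Qed.

Definition hull : structure L := @Structure L {x : N | dcl P0 x}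
  (fun k c args => exist (dcl P0) (fun_of N c (fun i => sval (args i)))
                     (dcl_fun c (fun i => svalP (args i))))
  (fun k r args => rel_of N r (fun i => sval (args i))).

(** This is the Tarski-Vaught test. A counterexample outside the closure of the parameters lies in
    an interval of counterexamples with ends in the hull, and [value_between] finds a named point
    there. *)
Lemma hull_elementary : elementary (sval : hull -> N).
Proof.
have evalE n (t : term L n) (e : 'I_n -> hull) : sval (eval e t) = eval (fun i => sval (e i)) t.
  by elim: t => //= k c ts IH; congr fun_of; apply: funext.
have sval_inj (x y : hull) : sval x = sval y -> x = y.
  by case: x y => x px [y py] /= xy; apply: eq_exist.
move=> n f; elim: f => [{}n|{}n t u|{}n k r ts|{}n f IHf g IHg|{}n f IHf] e /=.
- by [].
- by rewrite -!evalE; split=> [->//|/sval_inj].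
- by rewrite (funext (fun i => evalE _ (ts i) e)).
- by rewrite IHf IHg.
split=> H x; last by apply/IHf; rewrite (map_snoc sval); apply: H.
apply: contrapT => nx.
set a := fun i => sval (e i) in nx *.
pose X := [set y | ~ sat f (snoc a y)].
have [y [Xy Py]] : exists y, X y /\ dcl P0 y.
  have aP : range a `<=` dcl P0 by move=> _ [i _ <-]; apply: svalP.
  have [ax|ax] := pselect (dcl (range a) x); first by exists x; split=> //; apply: dcl_trans aP _ ax.
  have [|b [c [bP cP Ix IX]]] := @interval_around _ _ NG NO _ a X x _ nx ax; first by exists (Not f).
  have [||u [w [uP wP uw uwI]]] := @interval_shrink _ _ NG P0 b c x _ _ Ix.
  - by case: b bP {Ix IX} => //= b; apply: dcl_trans aP _.
  - by case: c cP {Ix IX} => //= c; apply: dcl_trans aP _.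
  have [v [_ uv vw]] := value_between c0 uP wP uw.
  by exists (h v); split; [apply: IX (uwI _ uv vw)|apply: dcl_incl; exists v].
apply: Xy; have /IHf := H (exist _ y Py).
by rewrite (map_snoc sval).
Qed.

Definition hull_e : structure (lang_e L) := @Structure (lang_e L) hull
  (fun k c => @fun_of L hull k c)
  (fun k r => match r in rel_sym_e _ k return ('I_k -> hull) -> Prop with
     | old_rsym _ r => rel_of hull r
     | P_sym => fun args => P0 (sval (args ord0))
     | E_sym => fun args => exists v w,
         [/\ sval (args ord0) = h v, sval (args ord_max) = h w & color v = color w]
     end).

(** Density of [P] and of the classes comes from [value_between], independence from [value_indep];
    [E] is transitive because by [value_inj] a point has only one name, hence one colour. *)
Lemma hull_Te : models hull_e (Te T).
Proof.
have hull_lt (x y : hull) : x <o y <-> sval x <o sval y.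
  by rewrite /lt_of /= (tnth2_map sval).
have hP v : dcl P0 (h v) by apply: dcl_incl; exists v.
apply/models_Te; split.
- move=> f Tf; have := NT Tf; rewrite /holds.
  by move=> H; apply/hull_elementary; rewrite (env0E (fun i => _)).
- move=> u w [x [_ [/= ux xw]]].
  have [|v [_ uv vw]] := value_between c0 (svalP u) (svalP w).
    by apply: (lt_trans NG (y := sval x)); apply/hull_lt.
  exists (exist _ (h v) (hP v)); split; first by exists v.
  by split; apply/hull_lt.
- move=> s [v _ hv] /dclP[n [a [aP [f fs]]]].
  have /choice[args argsE] : forall i, exists w, h w = sval (a i).
    by move=> i; have [[w _ wE] _] := aP i; exists w.
  apply: (@value_indep _ args v) => [i iv|].
    have [_] := aP i; apply; case: (a i) (argsE i) => x px /= xE.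
    by case: s hv {fs aP} => s ps /= hv; apply: eq_exist; rewrite -xE iv.
  apply/dcl_rangeP; exists f => y.
  (* That [f] defines [s] over [a] is itself a formula [g], which passes from the hull to [N]. *)
  have [g gP] : udef (fun (M : structure L) (e : 'I_n.+1 -> M) =>
      forall y, sat f (snoc (fun i => e (lift ord_max i)) y) <-> y = e ord_max).
    by udef_auto.
  have /(hull_elementary g)/gP/(_ y) : sat g (snoc (a : 'I_n -> hull) s).
    by apply/gP => z; rewrite snoc_eta snoc_max; apply: fs.
  rewrite snoc_max -hv (_ : (fun i => _) = fun i => h (args i)) //.
  by apply: funext => i; rewrite snoc_lift -argsE.
- apply/models_T2; split.
  + by move=> x y [v [w [xv yw _]]]; split; [exists v|exists w].
  + by move=> x [v _ vx]; exists v, v.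
  + by move=> x y [v [w [xv yw vw]]]; exists w, v.
  + move=> x y z [v [w [xv yw vw]]] [w' [u [yw' zu wu]]]; exists v, u; split=> //.
    by rewrite vw -wu; congr color; apply: value_inj; rewrite -yw -yw'.
- move=> x [v _ vx] u w [y [_ [/= uy yw]]].
  have [|v' [vE uv vw]] := value_between (color v) (svalP u) (svalP w).
    by apply: (lt_trans NG (y := sval y)); apply/hull_lt.
  exists (exist _ (h v') (hP v')); split; first by exists v, v'.
  by split; apply/hull_lt.
Qed.

Lemma hull_color c : exists x : hull_e, exists v, sval x = h v /\ color v = c.
Proof.
have [v [vc _ _]] := value_between c (dcl_zero P0) (dcl_one P0) (lt01 NG).
have hv : dcl P0 (h v) by apply: dcl_incl; exists v.
by exists (exist _ (h v) hv), v.
Qed.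

Lemma hull_classes : exists e : C -> reduct hull_e,
  [/\ forall c, P_of (e c), forall c d, E_of (e c) (e d) -> c = d
     & forall x, P_of x -> exists c, E_of (e c) x].
Proof.
have /choice[e eP] := hull_color; exists e; split.
- by move=> c; have [v [ev _]] := eP c; exists v.
- move=> c d [v [w [/= cv dw vw]]].
  have [v' [cv' <-]] := eP c; have [w' [dw' <-]] := eP d.
  have -> : v' = v by apply: value_inj; rewrite -cv' -cv.
  by have -> : w' = w by apply: value_inj; rewrite -dw' -dw.
- by move=> x [v _ vx]; exists (color v); have [w [ew wv]] := eP (color v); exists w, v.
Qed.

End GenericModel.

(** The colours [C] become the classes, so that one construction covers every number of classes;
    [c0] is the colour used when any point of [P] will do. *)
Lemma Te_model (L : og_language) (T : theory L) (C : Type) (c0 : C) :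
  satisfiable T -> ominimal_theory T -> (forall f, dense_og_axiom f -> entails T f) ->
  exists M : structure (lang_e L), models M (Te T) /\ exists e : C -> reduct M,
  [/\ forall c, P_of (e c), forall c d, E_of (e c) (e d) -> c = d
     & forall x, P_of x -> exists c, E_of (e c) x].
Proof.
move=> [M MT] OM OG.
have [lt [lt_irr lt_trans lt_total lt_wf lt_rank]] := well_order_refining (@name_rank L C).
have [N [j [jel [h [h1 h2]]]]] := generic_values lt_wf lt_rank (models_T_dense_og OG MT).
have NT := models_elementary jel MT.
exists (hull_e h); split.
  exact: (hull_Te c0 OM OG lt_irr lt_trans lt_total NT h1 h2).
exact: (hull_classes OM OG lt_irr lt_trans lt_total NT h1 h2).
Qed.

Theorem theorem2p16 (L : og_language) (T : theory L)
    (T_complete : complete T)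
    (T_ominimal : ominimal_theory T)
    (T_dense_og : forall f, dense_og_axiom f -> entails T f)
    (p : option nat) (p_pos : p <> Some 0%N) :
  complete (Te_p T p).
Proof.
split; last exact: Te_p_decides.
have [T_sat _] := T_complete.
case: p p_pos => [[//|n]|] _.
  have [M [MT [e [eP eI eS]]]] := Te_model (ord0 : 'I_n.+1) T_sat T_ominimal T_dense_og.
  exists M; apply/models_Te_p; split=> //; apply/holds_exactly_classes; exists e; split=> //.
  by move=> i k /eqP ik /eI.
have [M [MT [e [eP eI eS]]]] := Te_model 0%N T_sat T_ominimal T_dense_og.
exists M; apply/models_Te_p; split=> // n; apply/holds_at_least_classes.
(* The coercion of ['I_n] into [nat] picks [n] distinct colours. *)
exists (fun i => e i); split=> // i k /eqP ik /eI/val_inj; exact: ik.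
Qed.
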